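(* Let $(X_t)_{t\in J}$ be a centered continuous additive process, represented as $X_t=B_{V(t)}$, and suppose that $V$ is strictly increasing on $J$. Then, almost surely, $$\max\left\{2-\frac{\alpha_*}{2},\,1\right\}\le \dim_H \mathcal{G}(X,J)\le 2-\frac{\alpha^*}{2},$$ where $\alpha_*=\alpha_*(J)$ and $\alpha^*=\alpha^*(J)$.
   Context: $J=[0,S]$ with $0<S\le\infty$ (meaning $[0,\infty)$ if $S=\infty$). A real-valued process $(X_t)_{t\in J}$ is an additive process if it has independent increments, $X_0=0$ almost surely, and it is continuous in probability. It is a continuous additive process if moreover its sample paths are almost surely continuous, and it is centered if $\mathbb{E}[X_t]=0$ for all $t$. A centered continuous additive process can be represented as $X_t=B_{V(t)}$, where $B$ is a standard Brownian motion with $B_0=0$ and $V(t)=\mathbb{E}[X_t^2]$ is a continuous nondecreasing function on $J$ with $V(0)=0$. The graph is $\mathcal{G}(X,E)=\{(t,X_t):t\in E\}\subset\mathbb{R}^2$, and $\dim_H$ is Hausdorff dimension. Let $I(t,\delta)$ be the open interval of length $\delta$ centered at $t$; all points $u_1,u_2$ below are taken in $J$. For $V$ strictly increasing on $J$ and $t\in J$, put $$\alpha^*(t)=\sup\Big\{\alpha\in[0,\infty):\lim_{\delta\to0}\ \sup_{u_1\ne u_2\in I(t,\delta)}\frac{|V(u_1)-V(u_2)|}{|u_1-u_2|^{\alpha}}=0\Big\},$$ $$\alpha_*(t)=\inf\Big\{\alpha\in[0,\infty):\lim_{\delta\to0}\ \sup_{u_1\ne u_2\in I(t,\delta)}\frac{|u_1-u_2|^{\alpha}}{|V(u_1)-V(u_2)|}=0\Big\}$$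 (with $\inf\emptyset=\infty$), and $\alpha^*(J)=\inf_{t\in J}\alpha^*(t)$, $\alpha_*(J)=\inf_{t\in J}\alpha_*(t)$. *)

(* Defs.v *)
From HB Require Import structures.
From mathcomp Require Import all_boot all_order all_algebra.
From mathcomp Require Import all_classical all_reals all_analysis.
Set Implicit Arguments.
Unset Strict Implicit.
Unset Printing Implicit Defensive.
Import Order.TTheory GRing.Theory Num.Theory.
Import numFieldNormedType.Exports.
Local Open Scope classical_set_scope.
Local Open Scope ring_scope.

(* [0, S] when S is finite, [0, +oo[ when S = +oo. *)
Definition time_interval (R : realType) (S : \bar R) : set R :=
  [set t | 0 <= t /\ (t%:E <= S)%E].

Section hausdorff_dimension.
Context {R : realType}.
Implicit Types (A U : set (R * R)) (p q : R * R).

(* The library's norm on R * R is the sup norm, hence the explicit formula. *)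
Definition edist p q : R :=
  Num.sqrt ((p.1 - q.1) ^+ 2 + (p.2 - q.2) ^+ 2).

(* The union with [set 0] gives the empty set diameter 0 instead of -oo. *)
Definition diam U : \bar R :=
  ereal_sup ([set 0%E] `|`
    [set x | exists p q, [/\ U p, U q & x = (edist p q)%:E]]).

(* |U|^s, with the convention that it is 0 on the empty set (also for s = 0);
   only used on sets of finite diameter. *)
Definition diam_pow (s : R) U : \bar R :=
  if `[< U = set0 >] then 0%E else (fine (diam U) `^ s)%:E.

Definition delta_cover (delta : R) A (U : nat -> set (R * R)) : Prop :=
  A `<=` \bigcup_i U i /\ forall i, (diam (U i) <= delta%:E)%E.

Definition hausdorff_content (s delta : R) A : \bar R :=
  ereal_inf [set (\sum_(0 <= i <oo) diam_pow s (U i))%E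
            | U in delta_cover delta A].

(* The content is nonincreasing in delta, so that the limit as delta -> 0+ is
   the supremum over delta > 0. *)
Definition hausdorff_measure (s : R) A : \bar R :=
  ereal_sup [set hausdorff_content s delta A | delta in [set e : R | 0 < e]].

Definition hausdorff_dim A : \bar R :=
  ereal_inf [set s%:E | s in
    [set s : R | 0 <= s /\ hausdorff_measure s A = 0%E]].

Definition graph_on (f : R -> R) (E : set R) : set (R * R) :=
  [set (t, f t) | t in E].

End hausdorff_dimension.

Section processes.
Context d (T : measurableType d) (R : realType) (P : probability T R).

(* The product rule over the whole finite family contains the product rules
   over its subfamilies: take A i = setT for the omitted indices. *)
Definition mutually_independent n (Y : 'I_n -> T -> R) : Prop :=
  forall A : 'I_n -> set R, (forall i, measurable (A i)) ->
    P (\bigcap_i (Y i @^-1` A i)) = (\prod_(i < n) P (Y i @^-1` A i))%E.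

(* A process indexed by a set J of times is a family (X t) indexed by R of
   which only the members with t in J matter. *)
Implicit Types (J : set R) (X : R -> {RV P >-> R}).

Definition independent_increments J X : Prop :=
  forall (n : nat) (t : nat -> R),
    (forall i, (i <= n)%N -> J (t i)) ->
    (forall i, (i < n)%N -> t i < t i.+1) ->
    mutually_independent (fun (i : 'I_n) w => X (t i.+1) w - X (t i) w).

Definition continuous_in_probability J X : Prop :=
  forall s, J s -> forall e : R, 0 < e ->
    P [set w | e < `|X t w - X s w|] @[t --> within J (nbhs s)] --> 0%E.

Definition continuous_paths J X : Prop :=
  {ae P, forall w, {within J, continuous (fun t => X t w)}}.

Record additive_process J X : Prop := AdditiveProcess {
  additive_indep : independent_increments J X ;
  additive_start : {ae P, forall w, X 0 w = 0} ;
  additive_cvg : continuous_in_probability J X }.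

Definition centered J X : Prop :=
  forall t, J t -> P.-integrable setT (EFin \o X t) /\ ('E_P[X t] = 0)%E.

Record centered_continuous_additive_process J X : Prop :=
  CenteredContinuousAdditiveProcess {
    cca_additive : additive_process J X ;
    cca_continuous : continuous_paths J X ;
    cca_centered : centered J X }.

(* Standard Brownian motion with time set K, a subset of [0, +oo[ containing 0.
   The restriction to K of a Brownian motion on [0, +oo[ is one. *)
Record standard_brownian_motion (K : set R) (B : R -> {RV P >-> R}) : Prop :=
  StandardBrownianMotion {
    sbm_start : {ae P, forall w, B 0 w = 0} ;
    sbm_indep : independent_increments K B ;
    sbm_normal : forall s t, K s -> K t -> s < t ->
      forall A : set R, measurable A ->
        P [set w | A (B t w - B s w)] = normal_prob 0 (Num.sqrt (t - s)) A ;
    sbm_continuous : continuous_paths K B }.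

End processes.

Section local_exponents.
Context {R : realType} (J : set R) (V : R -> R).

(* Ordered pairs of distinct points of J in the open interval I(t, delta) of
   length delta centered at t. *)
Definition distinct_pairs (t delta : R) : set (R * R) :=
  [set u | [/\ J u.1, J u.2, u.1 != u.2,
     u.1 \in `]t - delta / 2, t + delta / 2[ &
     u.2 \in `]t - delta / 2, t + delta / 2[ ]].

Definition alpha_upper_at (t : R) : \bar R :=
  ereal_sup [set a%:E | a in [set a : R | 0 <= a /\
    ereal_sup [set (`|V u.1 - V u.2| / `|u.1 - u.2| `^ a)%:E
              | u in distinct_pairs t delta] @[delta --> 0^'+] --> 0%E]].

Definition alpha_lower_at (t : R) : \bar R :=
  ereal_inf [set a%:E | a in [set a : R | 0 <= a /\
    ereal_sup [set (`|u.1 - u.2| `^ a / `|V u.1 - V u.2|)%:E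
              | u in distinct_pairs t delta] @[delta --> 0^'+] --> 0%E]].

Definition alpha_upper : \bar R := ereal_inf [set alpha_upper_at t | t in J].

Definition alpha_lower : \bar R := ereal_inf [set alpha_lower_at t | t in J].

End local_exponents.

(* Main.v *)
Require Import Defs.
From HB Require Import structures.
From mathcomp Require Import all_boot all_order all_algebra.
From mathcomp Require Import all_classical all_reals all_analysis.
From mathcomp Require Import measurable_realfun ring lra.
Set Implicit Arguments.
Unset Strict Implicit.
Unset Printing Implicit Defensive.
Import Order.TTheory GRing.Theory Num.Theory.
Import numFieldNormedType.Exports.
Local Open Scope classical_set_scope.
Local Open Scope ring_scope.

(** The only probabilistic input is that, for s < t in J, the increment
X t - X s is normal with mean 0 and variance V t - V s > 0, inherited from the
Brownian motion ([brownian_gaussian_increments]); the exponents of V are then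
exponents of these variances.

Lower bound. For c > alpha_lower some t in J has an exponent alpha < c with
V v - V u >= (v - u)^alpha for all u < v near t ([alpha_lower_lt]); let [a, b]
be a segment of J near t. By the energy method it is enough that the Riesz
s-energy of the graph over [a, b] is finite. Instead of an integral over
[a, b]^2, which would need joint measurability of the process, the energy is
taken over the pairs of distinct points of the dyadic grids of [a, b]
([grid_energy]). If these discrete energies are bounded along a subsequence
then the graph is not a null set of the s-dimensional Hausdorff measure
([hausdorff_measure_gt0_of_energy]): a cover may be taken finite by
compactness, each grid point is assigned to a covering set containing it, and
the Cauchy--Schwarz inequality bounds the sum of the diameters to the power s
from below by the inverse of the energy. A normal variable of standard
deviation sigma has density at most 1 / sigma, so for s > 1 the expected kernel
at time distance tau is, up to an additive constant, at most of order
tau^(1 - s) / sigma, hence of order tau^(1 - s - alpha / 2)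
([gaussian_riesz_le]). This is summable over the grids
when s < 2 - alpha / 2, uniformly in the level, and Fatou's lemma gives the
bounded subsequence almost surely ([ae_hausdorff_measure_gt0]). For s < 1 the
kernel is at most tau^(-s) whatever the function, so a continuous graph over a
nondegenerate segment has dimension at least 1
([hausdorff_measure_lt1_neq0]).

Upper bound. For 0 <= c < alpha_upper, V is Hoelder continuous of exponent c on
every segment [0, b] of J, by compactness ([alpha_upper_hoelder]); in
particular c <= 1, as V is not constant. For gamma < c / 2, the Gaussian tail
and the Borel--Cantelli lemma bound all increments over the dyadic cells of
level n by 2^(- n gamma) for n large ([ae_increments_le]); chaining extends
the bound to the oscillation of the path over a cell ([dyadic_chaining]). Each
of the 2^n cells is then covered by O(2^(n (1 - gamma))) squares of side of
order 2^(-n), and the graph is a null set for every s > 2 - gamma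
([hausdorff_measure_graph_eq0]). For s > 2 the same covering works with
gamma = 0, as the paths are bounded on segments.

The exceptional events are collected over rational exponents
([ae_forall_rat]), and J is exhausted by countably many segments. *)

(* The Euclidean distance of the plane, as opposed to the extended distance of
   a pseudometric space, which has the same name. *)
Local Notation edist := Defs.edist.

(** * Real powers and geometric sums *)

Section real_powers.
Context {R : realType}.

Lemma powR_gt1 (x p : R) : 1 < x -> 0 < p -> 1 < x `^ p.
Proof.
move=> x1 p0; rewrite /powR gt_eqF; last exact: lt_trans x1.
by rewrite expR_gt1 mulr_gt0// ln_gt0.
Qed.

Lemma powR_lt1 (x p : R) : 1 < x -> p < 0 -> x `^ p < 1.
Proof.
move=> x1 p0; rewrite -[_ `^ _]invrK -powRN.
have Np : 1 < x `^ (- p) by apply: powR_gt1; rewrite ?oppr_gt0.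
by rewrite invf_lt1// (lt_trans ltr01).
Qed.

Lemma exprn_powR (x y : R) n : 0 <= x -> (x ^+ n) `^ y = (x `^ y) ^+ n.
Proof.
by move=> x0; rewrite -powR_mulrn// powRAC powR_mulrn// powR_ge0.
Qed.

Lemma geometric_sum_le (n : nat) (r : R) : 0 < r -> r < 1 ->
  \sum_(0 <= i < n) r ^+ i <= (1 - r)^-1.
Proof.
move=> r0 r1; have := @geometric_le_lim R n 1 r ler01 r0.
rewrite ger0_norm ?(ltW r0)// => /(_ r1); rewrite div1r; apply: le_trans.
rewrite /series/= le_eqVlt; apply/orP; left; apply/eqP.
by apply: eq_bigr => j _; rewrite /geometric/= mul1r.
Qed.

Lemma geometric_eventually_le (K p eps : R) : 0 <= p -> p < 1 -> 0 < eps ->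
  exists n0, forall n, (n0 <= n)%N -> K * p ^+ n <= eps.
Proof.
move=> p0 p1 eps0.
have : geometric K p @ \oo --> 0 by apply: cvg_geometric; rewrite ger0_norm.
move=> /cvgr0Pnorm_le/(_ _ eps0)[n0 _ h]; exists n0 => n nn0.
by apply: le_trans (h n nn0); rewrite /geometric/= ler_norm.
Qed.

End real_powers.

(** * Diameters and Hausdorff null sets in the plane *)

Section plane_diameter.
Context {R : realType}.
Implicit Types (A U : set (R * R)) (p q r : R * R).

Lemma edist_ge0 p q : 0 <= edist p q.
Proof. exact: sqrtr_ge0. Qed.

Lemma edistC p q : edist p q = edist q p.
Proof. by rewrite /edist -(opprB q.1) -(opprB q.2) !sqrrN. Qed.

Lemma edist_sqr p q : edist p q ^+ 2 = (p.1 - q.1) ^+ 2 + (p.2 - q.2) ^+ 2.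
Proof. by rewrite sqr_sqrtr// addr_ge0 ?sqr_ge0. Qed.

Lemma edist_ge_fst p q : `|p.1 - q.1| <= edist p q.
Proof.
by rewrite -sqrtr_sqr ler_sqrt ?addr_ge0 ?sqr_ge0// lerDl sqr_ge0.
Qed.

Lemma edist_ge_snd p q : `|p.2 - q.2| <= edist p q.
Proof.
by rewrite -sqrtr_sqr ler_sqrt ?addr_ge0 ?sqr_ge0// lerDr sqr_ge0.
Qed.

Lemma edist_le_add p q : edist p q <= `|p.1 - q.1| + `|p.2 - q.2|.
Proof.
rewrite -(@ler_pXn2r _ 2) ?nnegrE ?edist_ge0 ?addr_ge0//.
rewrite edist_sqr [leRHS]sqrrD !real_normK ?num_real// [leRHS]addrAC lerDl.
by rewrite mulrn_wge0// mulr_ge0.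
Qed.

Lemma edist_triangle p q r : edist p r <= edist p q + edist q r.
Proof.
rewrite -(@ler_pXn2r _ 2) ?nnegrE ?edist_ge0 ?addr_ge0 ?edist_ge0//.
rewrite sqrrD !edist_sqr.
set a := p.1 - q.1; set b := p.2 - q.2; set c := q.1 - r.1; set e := q.2 - r.2.
have -> : p.1 - r.1 = a + c by rewrite /a /c; ring.
have -> : p.2 - r.2 = b + e by rewrite /b /e; ring.
(* Cauchy--Schwarz, through the Lagrange identity *)
suff : a * c + b * e <= edist p q * edist q r by nra.
have [h|h] := leP 0 (a * c + b * e); last first.
  by rewrite (le_trans (ltW h))// mulr_ge0 ?edist_ge0.
rewrite -(@ler_pXn2r _ 2) ?nnegrE ?mulr_ge0 ?edist_ge0//.
rewrite exprMn !edist_sqr -/a -/b -/c -/e.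
have := sqr_ge0 (a * e - b * c); nra.
Qed.

Lemma diam_ge0 U : (0 <= diam U)%E.
Proof. by apply: ereal_sup_ubound; left. Qed.

Lemma edist_le_diam U p q : U p -> U q -> ((edist p q)%:E <= diam U)%E.
Proof. by move=> Up Uq; apply: ereal_sup_ubound; right; exists p, q. Qed.

Lemma diam_le U (e : R) : 0 <= e ->
  (forall p q, U p -> U q -> edist p q <= e) -> (diam U <= e%:E)%E.
Proof.
move=> e0 h; apply: ge_ereal_sup => _ [->|[p [q [Up Uq ->]]]].
  by rewrite lee_fin.
by rewrite lee_fin h.
Qed.

Lemma diam_fin_num U (e : R) : (diam U <= e%:E)%E -> diam U \is a fin_num.
Proof.
move=> h; rewrite ge0_fin_numE ?diam_ge0//.
by rewrite (le_lt_trans h)// ltry.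
Qed.

Lemma edist_le_fine_diam U (e : R) p q : (diam U <= e%:E)%E ->
  U p -> U q -> edist p q <= fine (diam U).
Proof.
move=> h Up Uq; rewrite -lee_fin fineK ?(diam_fin_num h)//.
exact: edist_le_diam.
Qed.

Lemma diam_pow_ge0 (s : R) U : (0 <= diam_pow s U)%E.
Proof.
by rewrite /diam_pow; case: ifP => // _; rewrite lee_fin powR_ge0.
Qed.

Lemma diam_powE (s : R) U : 0 < s -> diam_pow s U = (fine (diam U) `^ s)%:E.
Proof.
move=> s0; rewrite /diam_pow; case: ifPn => // /asboolP ->.
suff -> : diam (set0 : set (R * R)) = 0%E by rewrite /= powR0// gt_eqF.
apply/eqP; rewrite eq_le diam_ge0 andbT.
by apply: diam_le.
Qed.

Lemma diam_pow_set0 (s : R) : diam_pow s set0 = 0%E.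
Proof. by rewrite /diam_pow; case: ifPn => // /asboolP. Qed.

End plane_diameter.

Section hausdorff_null_sets.
Context {R : realType}.
Implicit Types (A B : set (R * R)).

Lemma hausdorff_content_ge0 (s e : R) A : (0 <= hausdorff_content s e A)%E.
Proof.
apply: le_ereal_inf_tmp => _ [U _ <-].
by apply: nneseries_ge0 => *; exact: diam_pow_ge0.
Qed.

Lemma hausdorff_measure_eq0P (s : R) A : hausdorff_measure s A = 0%E <->
  forall e eps : R, 0 < e -> 0 < eps -> exists U, delta_cover e A U /\
    (\sum_(0 <= i <oo) diam_pow s (U i) <= eps%:E)%E.
Proof.
split => [h e eps e0 eps0|h].
  have h0 : (hausdorff_content s e A < eps%:E)%E.
    apply: (@le_lt_trans _ _ 0%E); last by rewrite lte_fin.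
    by rewrite -h; apply: ereal_sup_ubound; exists e.
  have [_ [U cU <-] Ue] := ereal_inf_lt h0.
  by exists U; split => //; exact: ltW.
apply/eqP; rewrite eq_le; apply/andP; split.
  apply: ge_ereal_sup => _ [e /= e0 <-].
  apply/lee_addgt0Pr => eps eps0; rewrite add0e.
  have [U [cU Ue]] := h e eps e0 eps0.
  by apply: ge_ereal_inf; exists (\sum_(0 <= i <oo) diam_pow s (U i))%E => //;
    exists U.
apply: le_ereal_sup_tmp; exists (hausdorff_content s 1 A).
  by exists 1 => //=.
exact: hausdorff_content_ge0.
Qed.

Lemma hausdorff_measure_eq0_subset (s : R) A B : A `<=` B ->
  hausdorff_measure s B = 0%E -> hausdorff_measure s A = 0%E.
Proof.
move=> AB /hausdorff_measure_eq0P h.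
apply/hausdorff_measure_eq0P => e eps e0 eps0.
have [U [[BU dU] sU]] := h e eps e0 eps0.
by exists U; split => //; split => //; exact: subset_trans BU.
Qed.

Lemma hausdorff_measure_eq0_le (s t : R) A : 0 <= s -> s <= t ->
  hausdorff_measure s A = 0%E -> hausdorff_measure t A = 0%E.
Proof.
move=> s0; rewrite le_eqVlt => /predU1P[<-//|st].
have t0 : 0 < t by exact: le_lt_trans st.
move=> /hausdorff_measure_eq0P h; apply/hausdorff_measure_eq0P => e eps e0 eps0.
(* Diameters at most 1 make the power decrease with its exponent. *)
have [||U [[AU dU] Ue]] := h (Num.min e 1) eps; [by rewrite lt_min e0/=|by []|].
have dU1 i : (diam (U i) <= 1%:E)%E.
  by apply: (le_trans (dU i)); rewrite lee_fin ge_min lexx orbT.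
exists U; split.
  split => // i; apply: (le_trans (dU i)).
  by rewrite lee_fin ge_min lexx.
apply: le_trans Ue; apply: lee_nneseries => [*|i _]; first exact: diam_pow_ge0.
rewrite diam_powE// /diam_pow; case: ifPn => [/asboolP ->|_].
  have -> : diam (set0 : set (R * R)) = 0%E.
    by apply/eqP; rewrite eq_le diam_ge0 andbT; apply: diam_le.
  by rewrite /= powR0// gt_eqF.
rewrite lee_fin.
have := diam_ge0 (U i); have := dU1 i; have := diam_fin_num (dU1 i).
case: (diam (U i)) => [x| |]//= _; rewrite !lee_fin => x1 x0.
have [->|xn0] := eqVneq x 0; first by rewrite powR0 ?powR_ge0// gt_eqF.
by apply: ger_powR; [rewrite lt0r xn0 x0 x1|exact: ltW].
Qed.

Lemma hausdorff_measure_eq0_bigcup (s : R) (A : nat -> set (R * R)) :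
  (forall n, hausdorff_measure s (A n) = 0%E) ->
  hausdorff_measure s (\bigcup_n A n) = 0%E.
Proof.
move=> h; apply/hausdorff_measure_eq0P => e eps e0 eps0.
have hU n : {U | delta_cover e (A n) U /\
    (\sum_(0 <= i <oo) diam_pow s (U i) <= (eps / (2 ^ n.+1)%:R)%:E)%E}.
  apply: cid; apply: ((hausdorff_measure_eq0P s (A n)).1 (h n)) => //.
  by rewrite divr_gt0// ltr0n expn_gt0.
pose U n := sval (hU n).
have cU n : delta_cover e (A n) (U n) by have [] := svalP (hU n).
have sU n : (\sum_(0 <= i <oo) diam_pow s (U n i)
    <= (eps / (2 ^ n.+1)%:R)%:E)%E by have [] := svalP (hU n).
have /ppcard_eqP[f] : ([set: nat] #= [set: nat * nat])%card.
  by rewrite card_eq_sym; exact: card_nat2.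
exists (fun i => U (f i).1 (f i).2); split.
  split; last by move=> i; have [_] := cU (f i).1; apply.
  move=> x [n _ Anx]; have [/(_ x Anx) [j _ Ux] _] := cU n.
  have [g _ gK] : bijective f by exact: bijTT.
  by exists (g (n, j)) => //=; rewrite gK.
apply: le_trans (epsilon_trick0 xpredT (ltW eps0)).
apply: (@le_trans _ _
    (\sum_(n <oo) \sum_(0 <= i <oo) diam_pow s (U n i))%E); last first.
  apply: lee_nneseries => [n _ _|n _]; last exact: sU.
  by apply: nneseries_ge0 => *; exact: diam_pow_ge0.
rewrite le_eqVlt; apply/orP; left; apply/eqP; apply/esym.
transitivity (\esum_(l in [set: nat] `*` [set: nat])
    diam_pow s (U l.1 l.2))%E.
  rewrite (_ : _ `*` _ = setT `*`` (fun=> setT)); last by apply/seteqP; split.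
  rewrite -(@esum_esum _ _ _ _ _ (fun i j => diam_pow s (U i j))); last first.
    by move=> *; exact: diam_pow_ge0.
  rewrite nneseries_esumT; last first.
    by move=> n; apply: nneseries_ge0 => *; exact: diam_pow_ge0.
  apply: eq_esum => i _.
  by rewrite nneseries_esumT// => *; exact: diam_pow_ge0.
rewrite (reindex_esum [set: nat] _ f)//; last first.
  have := @bijTT _ _ f.
  by rewrite -setTT_bijective/= -[in X in set_bij _ X _ -> _](@setXTT nat nat).
rewrite nneseries_esumT => [|n]; last exact: diam_pow_ge0.
exact: eq_esum.
Qed.

(** The form in which covers are counted: the number of sets times a power of
a common bound for their diameters. The remaining sets of the sequence are
empty, which the convention on the power of the empty diameter makes free. *)
Lemma hausdorff_measure_eq0_of_finite_covers (s : R) A : 0 < s ->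
  (forall e eps : R, 0 < e -> 0 < eps ->
     exists (N : nat) (rho : R) (U : nat -> set (R * R)),
     [/\ rho <= e, N%:R * rho `^ s <= eps,
       A `<=` [set p | exists2 i, (i < N)%N & U i p] &
       forall i p q, (i < N)%N -> U i p -> U i q -> edist p q <= rho]) ->
  hausdorff_measure s A = 0%E.
Proof.
move=> s0 h; apply/hausdorff_measure_eq0P => e eps e0 eps0.
have [N [rho [U [re Ne AU dU]]]] := h e eps e0 eps0.
pose W i := if (i < N)%N then U i else set0.
have WU i p : W i p -> (i < N)%N /\ U i p by rewrite /W; case: ifPn.
have rho0 i p : W i p -> 0 <= rho.
  by move=> /WU[iN Up]; exact: (le_trans (edist_ge0 p p) (dU _ _ _ iN Up Up)).
have dW i : W i !=set0 -> (diam (W i) <= rho%:E)%E.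
  move=> [p Wp]; apply: diam_le; first exact: rho0 Wp.
  by move=> a b /WU[iN Ua] /WU[_ Ub]; exact: dU Ub.
have dW0 i : W i = set0 -> diam (W i) = 0%E.
  move=> ->; apply/eqP; rewrite eq_le diam_ge0 andbT; exact: diam_le.
exists W; split.
  split=> [p /AU[i iN Ui]|i]; first by exists i => //; rewrite /W iN.
  have [/dW0 ->|/set0P/dW/le_trans] := eqVneq (W i) set0.
    by rewrite lee_fin ltW.
  by apply; rewrite lee_fin.
have -> : (\sum_(0 <= i <oo) diam_pow s (W i)
     = \sum_(0 <= i < N) diam_pow s (W i))%E.
  rewrite (@nneseries_split _ _ 0 N) => [|*]; last exact: diam_pow_ge0.
  rewrite add0n (@eseries0 _ _ N) ?adde0// => i Ni _.
  by rewrite /W ltnNge Ni/= diam_pow_set0.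
apply: (@le_trans _ _ (\sum_(0 <= i < N) (rho `^ s)%:E)%E); last first.
  by rewrite sumEFin lee_fin sumr_const_nat subn0 -mulr_natl.
apply: lee_sum => i _; have [->|W0] := eqVneq (W i) set0.
  by rewrite diam_pow_set0 lee_fin powR_ge0.
have /set0P [p Wp] := W0.
have di := dW _ (ex_intro _ p Wp).
rewrite diam_powE// lee_fin; apply: ge0_ler_powR; rewrite ?nnegrE//.
- exact: ltW.
- exact/fine_ge0/diam_ge0.
- exact: rho0 Wp.
- by rewrite -lee_fin fineK// (diam_fin_num di).
Qed.

End hausdorff_null_sets.

(** * Dyadic grids *)

Section dyadic_grids.
Context {R : realType}.

Definition grid (a b : R) (n j : nat) : R := a + (b - a) * j%:R / 2 ^+ n.

Lemma gridB (a b : R) (n j k : nat) :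
  grid a b n k - grid a b n j = (b - a) * (k%:R - j%:R) / 2 ^+ n.
Proof. by rewrite /grid; ring. Qed.

Lemma gridBS (a b : R) n k :
  grid a b n k.+1 - grid a b n k = (b - a) / 2 ^+ n.
Proof. by rewrite gridB -natr1; ring. Qed.

Lemma grid0 (a b : R) n : grid a b n 0 = a.
Proof. by rewrite /grid mulr0 mul0r addr0. Qed.

Lemma grid_max (a b : R) n : grid a b n (2 ^ n) = b.
Proof.
by rewrite /grid natrX mulfK ?subrKC.
Qed.

(** Subdividing a cell of level n into 2^p cells gives cells of level n + p, so
statements about [a, b] apply inside a cell. *)
Lemma grid_grid (a b : R) (n k p j : nat) :
  grid (grid a b n k) (grid a b n k.+1) p j =
  grid a b (n + p) (k * 2 ^ p + j).
Proof.
rewrite {1}/grid gridB /grid natrD natrM natrX exprD -natr1.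
have : (2 ^+ n : R) != 0 by rewrite expf_neq0.
have : (2 ^+ p : R) != 0 by rewrite expf_neq0.
by move: (2 ^+ n : R) (2 ^+ p : R) => u v v0 u0; field; rewrite u0 v0.
Qed.

Lemma grid_itv (a b : R) (n j : nat) : a <= b -> (j <= 2 ^ n)%N ->
  grid a b n j \in `[a, b].
Proof.
move=> ab jn; have ba : 0 <= b - a by rewrite subr_ge0.
have j1 : j%:R / 2 ^+ n <= 1 :> R.
  by rewrite ler_pdivrMr ?exprn_gt0// mul1r -natrX ler_nat.
have j0 : 0 <= j%:R / 2 ^+ n :> R by rewrite divr_ge0.
rewrite in_itv/= /grid -mulrA; apply/andP; split.
  by rewrite lerDl mulr_ge0.
by rewrite -lerBrDl ler_piMr.
Qed.

Lemma grid_lt (a b : R) (n j k : nat) : a < b -> (j < k)%N ->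
  grid a b n j < grid a b n k.
Proof.
move=> ab jk; rewrite -subr_gt0 gridB divr_gt0 ?exprn_gt0// mulr_gt0//.
  by rewrite subr_gt0.
by rewrite subr_gt0 ltr_nat.
Qed.

Lemma exists_grid_cell (a b t : R) (n : nat) : a < b -> t \in `[a, b] ->
  exists2 k, (k < 2 ^ n)%N & t \in `[grid a b n k, grid a b n k.+1].
Proof.
move=> ab; rewrite in_itv/= => /andP[at_ tb].
have ba : 0 < b - a by rewrite subr_gt0.
have M0 : 0 < 2 ^+ n :> R by rewrite exprn_gt0.
have [->|tnb] := eqVneq t b.
  exists (2 ^ n).-1; first by rewrite prednK// expn_gt0.
  rewrite prednK ?expn_gt0// grid_max in_itv/= lexx andbT.
  rewrite -[leRHS](grid_max a b n).
  by apply/ltW/grid_lt => //; rewrite prednK// expn_gt0.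
have {}tb : t < b by rewrite lt_neqAle tnb.
pose x := (t - a) / (b - a) * 2 ^+ n.
have x0 : 0 <= x by rewrite mulr_ge0 ?(ltW M0)// divr_ge0 ?subr_ge0// ltW.
have tE : t = a + (b - a) * x / 2 ^+ n.
  by rewrite /x; field; rewrite !gt_eqF.
have xM : x < 2 ^+ n.
  by rewrite /x gtr_pMl// ltr_pdivrMr// mul1r ltrD2r.
have /andP[kx xk] := truncn_itv x0.
exists (Num.truncn x); first by rewrite -(ltr_nat R) natrX (le_lt_trans kx).
rewrite in_itv/= /grid tE; apply/andP; split.
  by rewrite lerD2l ler_pM2r ?invr_gt0// ler_pM2l.
by rewrite lerD2l ler_pM2r ?invr_gt0// ler_pM2l// ltW.
Qed.

Lemma within_continuous_near (K : set R) (f : R -> R) (x e : R) :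
  {within K, continuous f} -> K x -> 0 < e ->
  \forall y \near x, K y -> `|f x - f y| < e.
Proof.
move=> /subspace_continuousP cf Kx e0.
by move/cvgrPdist_lt : (cf x Kx) => /(_ _ e0); rewrite near_withinE.
Qed.

End dyadic_grids.

(** * The energy method for graphs *)

Section finite_energy.
Context {R : realType}.

Lemma sum_symmetric (M : nat) (F : nat -> nat -> R) :
  (forall j k, F j k = F k j) ->
  \sum_(0 <= k < M) \sum_(0 <= j < M) F j k =
  \sum_(0 <= k < M) F k k + 2 * \sum_(0 <= k < M) \sum_(0 <= j < k) F j k.
Proof.
move=> FC; elim: M => [|M IH]; first by rewrite !big_geq// mulr0 addr0.
rewrite !big_nat_recr//=.
under eq_bigr do rewrite big_nat_recr//=.
rewrite big_split/= IH.
under [X in _ + X + _]eq_bigr do rewrite FC.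
by ring.
Qed.

Lemma sum_class (M N : nat) (c : nat -> nat) (F : nat -> R) :
  (forall j, (j < M)%N -> (c j < N)%N) ->
  \sum_(0 <= j < M) F (c j) =
  \sum_(0 <= i < N) \sum_(0 <= j < M) (c j == i)%:R * F i.
Proof.
move=> cN; rewrite exchange_big_nat/=; apply: eq_big_nat => j /andP[_ jM].
transitivity (\sum_(0 <= i < N | i == c j) F i).
  by rewrite big_nat1_eq cN.
rewrite big_mkcond/=; apply: eq_bigr => i _; rewrite eq_sym.
by case: eqP => _; rewrite ?mul1r ?mul0r.
Qed.

(** Cauchy--Schwarz for a partition of M points into classes of weights w: with
n_i the size of the class i, the double sum is the sum of the n_i ^ 2 / w i. *)
Lemma sqr_sum_class_le (M N : nat) (c : nat -> nat) (w : nat -> R) :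
  (forall j, (j < M)%N -> (c j < N)%N) -> (forall i, 0 < w i) ->
  0 < \sum_(0 <= i < N) w i ->
  M%:R ^+ 2 <= (\sum_(0 <= i < N) w i) *
    \sum_(0 <= k < M) \sum_(0 <= j < M) (c j == c k)%:R / w (c k).
Proof.
move=> cN w0; set W := \sum_(0 <= i < N) w i => W0.
pose n i := \sum_(0 <= j < M) (c j == i)%:R : R.
have Mn : \sum_(0 <= i < N) n i = M%:R.
  have := sum_class (fun=> 1) cN; rewrite sumr_const_nat subn0 => ->.
  by apply: eq_bigr => i _; apply: eq_bigr => j _; rewrite mulr1.
have -> : \sum_(0 <= k < M) \sum_(0 <= j < M) (c j == c k)%:R / w (c k) =
    \sum_(0 <= i < N) n i ^+ 2 / w i.
  under eq_bigr do rewrite -mulr_suml.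
  rewrite (sum_class (fun i => n i / w i) cN); apply: eq_bigr => i _.
  by rewrite -mulr_suml -/(n i) mulrA.
(* the tangent line of the square at y = M / W *)
pose y := M%:R / W.
suff : 2 * y * M%:R - y ^+ 2 * W <= \sum_(0 <= i < N) n i ^+ 2 / w i.
  have -> : 2 * y * M%:R - y ^+ 2 * W = M%:R ^+ 2 / W.
    by rewrite /y; field; rewrite gt_eqF.
  by rewrite ler_pdivrMr// mulrC.
rewrite -Mn !mulr_sumr -sumrB; apply: ler_sum => i _.
rewrite ler_pdivlMr//; have := sqr_ge0 (n i - y * w i); nra.
Qed.

(** Points of one class i are at distance at most r i, so that their pairs
contribute at least (r i)^(-s) each to the energy; the term in K accounts for
the pairs of equal points, which the energy leaves out. *)
Lemma pair_energy_ge (M N : nat) (x : nat -> R * R) (c : nat -> nat)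
    (r : nat -> R) (s K : R) : 0 <= s ->
  (forall j, (j < M)%N -> (c j < N)%N) -> (forall i, 0 < r i) ->
  (forall j k, (j < k)%N -> (k < M)%N -> c j = c k ->
     0 < edist (x j) (x k) <= r (c k)) ->
  (forall i, (i < N)%N -> (r i `^ s)^-1 <= K) ->
  0 < \sum_(0 <= i < N) r i `^ s ->
  M%:R ^+ 2 <= (\sum_(0 <= i < N) r i `^ s) *
   (M%:R * K
    + 2 * \sum_(0 <= k < M) \sum_(0 <= j < k) (edist (x j) (x k) `^ s)^-1).
Proof.
move=> s0 cN r0 dr rK W0.
apply: le_trans (sqr_sum_class_le cN _ W0) _.
  by move=> i; exact: powR_gt0.
rewrite ler_pM2l//.
pose F j k := (c j == c k)%:R / (r (c k) `^ s).
rewrite -/(F _ _) (@sum_symmetric M F); last first.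
  by move=> j k; rewrite /F eq_sym; case: eqP => [->//|_]; rewrite !mul0r.
apply: lerD.
  rewrite -[leRHS](_ : \sum_(0 <= k < M) K = _); last first.
    by rewrite sumr_const_nat subn0 mulr_natl.
  apply: ler_sum_nat => k /andP[_ kM]; rewrite /F eqxx mul1r.
  exact/rK/cN.
rewrite ler_pM2l//; apply: ler_sum_nat => k /andP[_ kM].
apply: ler_sum_nat => j /andP[_ jk]; rewrite /F.
have [cjk|_] := eqVneq; last by rewrite mul0r invr_ge0 powR_ge0.
have /andP[d0 dk] := dr j k jk kM cjk.
rewrite mul1r lef_pV2 ?posrE ?powR_gt0//.
by apply: ge0_ler_powR; rewrite ?nnegrE// ltW.
Qed.

End finite_energy.

Section energy_method.
Context {R : realType}.

(** Riesz s-energy of the uniform measure on the 2^n points of the graph above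
the grid of level n, without the diagonal and with each unordered pair taken
once. *)
Definition grid_energy (s a b : R) (f : R -> R) (n : nat) : R :=
  (\sum_(0 <= k < 2 ^ n) \sum_(0 <= j < k)
    (edist (grid a b n j, f (grid a b n j))
           (grid a b n k, f (grid a b n k)) `^ s)^-1) / 2 ^+ n ^+ 2.

Lemma grid_energy_ge0 (s a b : R) (f : R -> R) n : 0 <= grid_energy s a b f n.
Proof.
rewrite /grid_energy divr_ge0 ?exprn_ge0//.
by apply: sumr_ge0 => k _; apply: sumr_ge0 => j _; rewrite invr_ge0 powR_ge0.
Qed.

(** A cover of small total power would violate [pair_energy_ge] at a level n
where the energy is at most L. Covering sets are enlarged into neighbourhoods,
so that finitely many of them cover the graph of the continuous function f over
the compact [a, b], at the cost of a constant factor 2^s + 1. *)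
Lemma hausdorff_measure_gt0_of_energy (s a b L : R) (f : R -> R) :
  0 < s -> a < b -> {within `[a, b], continuous f} ->
  (forall n0, exists2 n, (n0 <= n)%N & grid_energy s a b f n <= L) ->
  hausdorff_measure s (graph_on f `[a, b]) <> 0%E.
Proof.
move=> s0 ab cf hL /hausdorff_measure_eq0P H.
pose L' := 2 * `|L| + 1.
have L'0 : 0 < L' by rewrite /L' ltr_wpDl// mulr_ge0.
pose eps := (L' * (2 `^ s + 1) * 2)^-1.
have C0 : 0 < 2 `^ s + 1 :> R by rewrite ltr_wpDl// powR_ge0.
have eps0 : 0 < eps by rewrite invr_gt0 !mulr_gt0.
have [U [[AU dU] sU]] := H 1 eps ltr01 eps0.
pose d i := fine (diam (U i)).
have d0 i : 0 <= d i by exact/fine_ge0/diam_ge0.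
(* U i is enlarged by eta i; the s-th powers of 2 * eta i have sum at most eps,
   and taking r i to be a maximum splits its power without constants. *)
pose eta i := (eps / (2 ^ i.+1)%:R) `^ s^-1 / 2.
have eta0 i : 0 < eta i.
  by rewrite divr_gt0// powR_gt0// divr_gt0// ltr0n expn_gt0.
pose r i := Num.max (2 * d i) (2 * eta i).
have r0 i : 0 < r i by rewrite lt_max [X in _ || X]mulr_gt0// orbT.
have der i : d i + eta i <= r i.
  rewrite le_max; have [h|/ltW h] := leP (d i) (eta i); apply/orP.
    by right; rewrite mulr2n mulrDl mul1r lerD2r.
  by left; rewrite mulr2n mulrDl mul1r lerD2l.
have rs i : r i `^ s <= 2 `^ s * d i `^ s + eps / (2 ^ i.+1)%:R.
  have e1 : (2 * eta i) `^ s = eps / (2 ^ i.+1)%:R.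
    rewrite /eta mulrC divfK// -powRrM mulVf ?gt_eqF// powRr1//.
    by rewrite divr_ge0// ltW.
  rewrite /r; have [_|_] := leP (2 * d i) (2 * eta i).
    by rewrite e1 lerDr mulr_ge0 ?powR_ge0.
  by rewrite powRM// lerDl divr_ge0// ltW.
have W_le N : \sum_(0 <= i < N) r i `^ s <= (2 `^ s + 1) * eps.
  apply: le_trans (ler_sum _ (fun i _ => rs i)) _.
  rewrite big_split/= -mulr_sumr mulrDl mul1r; apply: lerD.
    rewrite ler_pM2l ?powR_gt0//.
    rewrite -lee_fin -sumEFin; apply: le_trans sU.
    under eq_bigr do rewrite -diam_powE//.
    by apply: nneseries_lim_ge => *; exact: diam_pow_ge0.
  rewrite -lee_fin -sumEFin; apply: le_trans (epsilon_trick0 xpredT (ltW eps0)).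
  by apply: nneseries_lim_ge => *; rewrite lee_fin divr_ge0// ltW.
pose O i t := exists2 p, U i p & edist p (t, f t) < eta i / 2.
have Od i t u : O i t -> O i u -> edist (t, f t) (u, f u) <= r i.
  move=> [p Up pt] [q Uq qu]; apply: le_trans (der i).
  have h1 := edist_triangle (t, f t) p (u, f u).
  have h2 := edist_triangle p q (u, f u).
  have h3 := edist_le_fine_diam (dU i) Up Uq.
  rewrite edistC in pt; rewrite /d; lra.
have [N hN] : exists N, `[a, b] `<=` [set t | exists2 i, (i < N)%N & O i t].
  have /compact_near_coveringP cK := @segment_compact R a b.
  have [|N _ hN] := cK nat \oo
      (fun N t => `[a, b]%classic t -> exists2 i, (i < N)%N & O i t) _.
    move=> t abt; have [i _ Ui] := AU (t, f t) (ex_intro2 _ _ t abt erefl).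
    have e4 : 0 < eta i / 4 by rewrite divr_gt0.
    exists ([set u | `|t - u| < eta i / 4 /\
        (`[a, b]%classic u -> `|f t - f u| < eta i / 4)],
        [set N | (i < N)%N]) => /=.
      split; last by exists i.+1.
      apply: filterI; last exact: within_continuous_near.
      exact: (@nbhsx_ballx _ _ t (eta i / 4) e4).
    move=> [u N]/= [[tu ftu] iN] abu; exists i => //; exists (t, f t) => //.
    apply: (le_lt_trans (edist_le_add _ _)) => /=.
    have := ftu abu; lra.
  by exists N => t abt; exact: (hN N (leqnn N) t abt abt).
(* K bounds the contribution of a single grid point to the diagonal, which is
   negligible once 2 ^ n exceeds K. *)
pose K := \sum_(0 <= i < N) (r i `^ s)^-1.
have rK i : (i < N)%N -> (r i `^ s)^-1 <= K.
  move=> iN; rewrite /K (bigD1_seq i) ?mem_index_iota ?iota_uniq//= lerDl.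
  by apply: sumr_ge0 => j _; rewrite invr_ge0 powR_ge0.
have [n0 n0K] : exists n0, forall n, (n0 <= n)%N -> K <= 2 ^+ n.
  exists (Num.truncn K).+1 => n nK.
  apply: (@le_trans _ _ n%:R).
    by rewrite (le_trans (ltW (truncnS_gt K)))// ler_nat.
  by rewrite -natrX ler_nat ltnW// ltn_expl.
have [n nn0 En] := hL n0.
have /choice[c hc] : forall j : nat, exists i : nat,
    (j < 2 ^ n)%N -> (i < N)%N /\ O i (grid a b n j).
  move=> j; have [jn|] := ltnP j (2 ^ n); last by exists 0%N.
  have [i iN Oi] := hN _ (grid_itv (ltW ab) (ltnW jn)).
  by exists i.
set W := \sum_(0 <= i < N) r i `^ s.
have W0 : 0 < W.
  rewrite /W; have [c0N _] := hc 0%N (expn_gt0 2 n).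
  rewrite (bigD1_seq (c 0%N)) ?mem_index_iota ?iota_uniq//= ltr_pwDl//.
    exact: powR_gt0.
  by apply: sumr_ge0 => j _; exact: powR_ge0.
pose x j := (grid a b n j, f (grid a b n j)).
have := @pair_energy_ge R (2 ^ n) N x c r s K (ltW s0)
  (fun j jn => (hc j jn).1) r0 _ rK W0.
have -> : \sum_(0 <= k < 2 ^ n) \sum_(0 <= j < k) (edist (x j) (x k) `^ s)^-1
    = grid_energy s a b f n * 2 ^+ n ^+ 2.
  by rewrite /grid_energy divfK// gt_eqF// !exprn_gt0.
rewrite natrX -/W; set M := 2 ^+ n.
have M0 : 0 < M :> R by rewrite exprn_gt0.
have KM : K <= M by exact: n0K.
move=> h.
have {}h :
    M ^+ 2 <= W * (M * K + 2 * (grid_energy s a b f n * M ^+ 2)).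
  apply: h => j k jk kn cjk; apply/andP; split.
    apply: lt_le_trans (edist_ge_fst _ _); rewrite /= distrC.
    by rewrite gtr0_norm subr_gt0 grid_lt.
  apply: Od; last by have [] := hc k kn.
  by rewrite -cjk; have [] := hc j (ltn_trans jk kn).
have WL : W * L' <= 2^-1.
  apply: le_trans (ler_wpM2r (ltW L'0) (W_le N)) _.
  suff -> : (2 `^ s + 1) * eps * L' = 2^-1 by [].
  rewrite /eps; move: C0 L'0.
  generalize (2 `^ s + 1) as u, L' as v => u v u0 v0.
  by field; rewrite !gt_eqF.
have EL : grid_energy s a b f n <= `|L| by rewrite (le_trans En)// ler_norm.
have : M ^+ 2 <= (W * L') * M ^+ 2.
  apply: (le_trans h); rewrite -mulrA ler_pM2l// /L'.
  have : M * K <= M * M by rewrite ler_pM2l.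
  have : grid_energy s a b f n * M ^+ 2 <= `|L| * M ^+ 2.
    by rewrite ler_pM2r// exprn_gt0.
  nra.
have MM : 0 < M ^+ 2 by rewrite exprn_gt0.
rewrite -{1}[M ^+ 2]mul1r ler_pM2r//.
move=> /le_trans/(_ WL); lra.
Qed.

(** Discrete version of the integral of x^(-beta) up to 2^n, by dyadic blocks:
the block of level n contributes at most (2^(1 - beta))^n, and these terms grow
geometrically. *)
Lemma sum_inv_powR_le (beta : R) : 0 <= beta -> beta < 1 ->
  exists2 C : R, 0 <= C & forall n,
    \sum_(0 <= m < 2 ^ n) (m.+1%:R `^ beta)^-1 <= C * (2 ^+ n) `^ (1 - beta).
Proof.
move=> b0 b1; pose q : R := 2 `^ (1 - beta).
have q1 : 1 < q.
  by apply: powR_gt1; rewrite ?subr_gt0// ltr1n.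
have q2 : q <= 2.
  by rewrite -[leRHS]powRr1// /q ler_powR ?ler1n// lerBlDr lerDl.
have q10 : 0 < q - 1 by rewrite subr_gt0.
exists (q - 1)^-1; first by rewrite invr_ge0 ltW.
have twoE n : (2 ^+ n : R) `^ (1 - beta) = q ^+ n.
  exact: exprn_powR.
elim=> [|n IH]; rewrite twoE.
  rewrite expn0 big_nat1 powR1 invr1 expr0 mulr1.
  by rewrite -[leLHS]invr1 lef_pV2 ?posrE//; lra.
rewrite (@big_cat_nat _ _ _ (2 ^ n)) ?leq0n ?leq_exp2l//=.
rewrite twoE in IH.
(* Each of the 2 ^ n terms of the block is at most (2 ^ n)^(-beta). *)
have blk : \sum_(2 ^ n <= m < 2 ^ n.+1) (m.+1%:R `^ beta)^-1 <= q ^+ n.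
  have -> : q ^+ n = \sum_(2 ^ n <= m < 2 ^ n.+1) ((2 ^+ n : R) `^ beta)^-1.
    rewrite sumr_const_nat expnS mul2n -addnn addnK -twoE -[RHS]mulr_natl natrX.
    by rewrite powRB ?powRr1// expf_neq0// implybT.
  apply: ler_sum_nat => m /andP[nm _].
  rewrite lef_pV2 ?posrE ?powR_gt0// ?exprn_gt0//.
  apply: ge0_ler_powR; rewrite ?nnegrE ?exprn_ge0//.
  by rewrite -natrX ler_nat ltnW.
apply: (le_trans (lerD IH blk)).
rewrite exprSr le_eqVlt; apply/orP; left; apply/eqP; field.
by rewrite gt_eqF.
Qed.

(** The kernel of exponent beta < 1 is integrable in dimension one, so that its
Riemann sums over the pairs of grid points are bounded. *)
Lemma grid_sum_le (beta a b : R) : 0 <= beta -> beta < 1 -> a < b ->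
  exists2 C : R, 0 <= C & forall n,
    \sum_(0 <= k < 2 ^ n) \sum_(0 <= j < k)
      ((grid a b n k - grid a b n j) `^ beta)^-1 <= C * 2 ^+ n ^+ 2.
Proof.
move=> b0 b1 ab; have ba : 0 < b - a by rewrite subr_gt0.
have [C C0 hC] := sum_inv_powR_le b0 b1.
exists (C / (b - a) `^ beta); first by rewrite divr_ge0// powR_ge0.
move=> n; set M : R := 2 ^+ n.
have M0 : 0 < M by rewrite exprn_gt0.
pose h := ((b - a) / M) `^ beta.
have inner k : (k < 2 ^ n)%N -> \sum_(0 <= j < k)
    ((grid a b n k - grid a b n j) `^ beta)^-1 <= h^-1 * (C * M `^ (1 - beta)).
  move=> kn.
  have -> : \sum_(0 <= j < k) ((grid a b n k - grid a b n j) `^ beta)^-1 =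
      h^-1 * \sum_(0 <= m < k) (m.+1%:R `^ beta)^-1.
    rewrite big_nat_rev/= mulr_sumr; apply: eq_big_nat => j /andP[_ jk].
    rewrite gridB -natrB; last by rewrite add0n leq_subr.
    rewrite add0n subKn// mulrAC powRM ?ler0n ?divr_ge0 ?exprn_ge0//.
      by rewrite invfM.
    exact: ltW.
  rewrite ler_wpM2l ?invr_ge0 ?powR_ge0//; apply: le_trans (hC n).
  rewrite (@big_cat_nat _ _ _ k 0 (2 ^ n))//=; last exact: ltnW.
  by rewrite lerDl sumr_ge0// => *; rewrite invr_ge0 powR_ge0.
apply: (@le_trans _ _ (\sum_(0 <= k < 2 ^ n) h^-1 * (C * M `^ (1 - beta)))).
  by apply: ler_sum_nat => k /andP[_ kn]; exact: inner.
rewrite sumr_const_nat subn0 -mulr_natl natrX -/M /h.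
have -> : ((b - a) / M) `^ beta = (b - a) `^ beta / M `^ beta.
  rewrite powRM ?invr_ge0 ?(ltW ba) ?(ltW M0)//; congr *%R.
  by rewrite -powR_inv1 ?(ltW M0)// powRAC powR_inv1 ?powR_ge0.
rewrite powRB ?powRr1 ?(ltW M0) ?(gt_eqF M0) ?implybT//.
have : 0 < M `^ beta by exact: powR_gt0.
have : 0 < (b - a) `^ beta by exact: powR_gt0.
move: (M `^ beta) ((b - a) `^ beta) => u v v0 u0.
rewrite le_eqVlt; apply/orP; left; apply/eqP; field.
by rewrite !gt_eqF.
Qed.

Lemma grid_energy_lt1_bounded (s a b : R) (f : R -> R) : 0 <= s -> s < 1 ->
  a < b -> exists L, forall n, grid_energy s a b f n <= L.
Proof.
move=> s0 s1 ab; have [C _ hC] := grid_sum_le s0 s1 ab.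
exists C => n; rewrite /grid_energy ler_pdivrMr ?exprn_gt0//.
apply: le_trans (hC n); apply: ler_sum_nat => k /andP[_ kn].
apply: ler_sum_nat => j /andP[_ jk].
have g0 : 0 < grid a b n k - grid a b n j by rewrite subr_gt0 grid_lt.
have g1 : grid a b n k - grid a b n j <=
    edist (grid a b n j, f (grid a b n j)) (grid a b n k, f (grid a b n k)).
  by apply: le_trans (edist_ge_fst _ _); rewrite /= distrC ler_norm.
rewrite lef_pV2 ?posrE ?powR_gt0//; last exact: lt_le_trans g1.
by apply: ge0_ler_powR; rewrite ?nnegrE ?edist_ge0// ltW.
Qed.

(** The distance of two points of a graph is at least that of their abscissae,
and s < 1 makes the corresponding kernel summable. The exponent s' serves the
case s = 0, as the energy method asks for a positive exponent. *)
Lemma hausdorff_measure_lt1_neq0 J (f : R -> R) (s a b : R) :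
  {within J, continuous f} -> 0 <= s -> s < 1 -> a < b ->
  `[a, b]%classic `<=` J -> hausdorff_measure s (graph_on f J) <> 0%E.
Proof.
move=> cf s0 s1 ab abJ hs.
pose s' := (s + 1) / 2.
have s'0 : 0 < s' by rewrite /s'; lra.
have s'1 : s' < 1 by rewrite /s'; lra.
have ss' : s <= s' by rewrite /s'; lra.
have [L hL] := grid_energy_lt1_bounded f (ltW s'0) s'1 ab.
apply: (@hausdorff_measure_gt0_of_energy s' a b L f s'0 ab).
- exact: continuous_subspaceW cf.
- by move=> n0; exists n0.
apply: hausdorff_measure_eq0_subset (hausdorff_measure_eq0_le s0 ss' hs).
by move=> _ [t abt <-]; exists t => //; exact: abJ.
Qed.

End energy_method.

(** * Normal laws of small balls and of tails *)

Section normal_bounds.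
Context {R : realType}.
Local Notation mu := lebesgue_measure.

(** The density is at most 1 / (sigma * sqrt (2 pi)), and 2 <= sqrt (2 pi). *)
Lemma normal_prob_ball_le (sigma r : R) : 0 < sigma -> 0 <= r ->
  (normal_prob 0 sigma [set x | (`|x| <= r)%R] <= (r / sigma)%:E)%E.
Proof.
move=> s0 r0; have sn0 : sigma != 0 by rewrite gt_eqF.
have -> : [set x : R | `|x| <= r] = `[- r, r]%classic.
  by apply/seteqP; split => x /=; rewrite in_itv/= ler_norml.
rewrite /normal_prob.
apply: (@le_trans _ _
    (\int[mu]_(x in `[(- r)%R, r]%classic) (normal_peak sigma)%:E)%E).
  apply: ge0_le_integral => //=.
  - by move=> x _; rewrite lee_fin normal_pdf_ge0.
  - by apply/measurable_EFinP/measurable_funTS; exact: measurable_normal_pdf.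
  - by move=> x _; rewrite lee_fin normal_pdf_ub.
rewrite integral_cst//= lebesgue_measure_itv/=.
have p0 := normal_peak_gt0 sn0.
case: ifPn => [_|_]; last by rewrite mule0 lee_fin divr_ge0// ltW.
have ps : normal_peak sigma * (2 * sigma) <= 1.
  rewrite /normal_peak mulrC ler_pdivrMr ?mul1r.
    rewrite -(ger0_norm (_ : 0 <= 2 * sigma)); last by rewrite mulr_ge0// ltW.
    rewrite -sqrtr_sqr ler_sqrt; last first.
      by rewrite mulrn_wge0// mulr_ge0 ?pi_ge0 ?sqr_ge0.
    have := pi_ge2 R; have := sqr_ge0 sigma; nra.
  by rewrite sqrtr_gt0 pmulrn_lgt0// mulr_gt0 ?pi_gt0// exprn_gt0.
rewrite -EFinB -EFinM lee_fin opprK ler_pdivlMr//.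
have := ler_wpM2r r0 ps; nra.
Qed.

Lemma expRN_le (m : nat) (y : R) : 0 < y ->
  expR (- y) <= (m.+1)`!%:R / y ^+ m.+1.
Proof.
move=> y0; rewrite expRN -[leRHS]invf_div lef_pV2 ?posrE ?expR_gt0//.
  by apply: le_trans (expR_ge1Dxn m (ltW y0)); rewrite lerDr.
by rewrite divr_gt0 ?exprn_gt0// ltr0n fact_gt0.
Qed.

Lemma normal_prob_tail_le (sigma l : R) : 0 < sigma -> 0 <= l ->
  (normal_prob 0 sigma [set x | (l < `|x|)%R]
     <= (2 * expR (- (l ^+ 2 / (4 * sigma ^+ 2))))%:E)%E.
Proof.
move=> s0 l0; set c := expR _.
have sn0 : sigma != 0 by rewrite gt_eqF.
have s2n0 : 2 * sigma != 0 by rewrite gt_eqF// mulr_gt0.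
have mA : measurable [set x : R | l < `|x|].
  rewrite (_ : [set x : R | _] = `]-oo, (- l)[%classic `|` `]l, +oo[%classic).
    by apply: measurableU.
  apply/seteqP; split => x /=; rewrite !in_itv/= andbT ltr_normr orbC.
    by move=> /orP[]; [rewrite ltrNr; left|right].
  by move=> [|->//]; [rewrite ltrNr => ->|rewrite orbT].
(* The density is compared with the normal density of standard deviation
   2 * sigma: the quotient is small off [- l, l]. *)
have pdf_le x : l < `|x| ->
    normal_pdf 0 sigma x <= 2 * c * normal_pdf 0 (2 * sigma) x.
  move=> lx; rewrite !normal_pdfE//.
  have -> : normal_peak (2 * sigma) = normal_peak sigma / 2.
    rewrite /normal_peak exprMn -mulrA -mulrnAr sqrtrM ?sqr_ge0//.
    by rewrite sqrtr_sqr ger0_norm// invfM mulrC.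
  have p0 := normal_peak_gt0 sn0.
  suff : normal_fun 0 sigma x <= c * normal_fun 0 (2 * sigma) x.
    by move=> h; have := ler_wpM2l (ltW p0) h; nra.
  rewrite /normal_fun /c -expRD ler_expR subr0.
  have l2 : l ^+ 2 <= x ^+ 2.
    rewrite -[leRHS]real_normK ?num_real//.
    by rewrite ler_pXn2r ?nnegrE// ltW.
  have s2 : 0 < sigma ^+ 2 by rewrite exprn_gt0.
  rewrite -subr_ge0.
  have -> : - (l ^+ 2 / (4 * sigma ^+ 2)) + - x ^+ 2 / ((2 * sigma) ^+ 2 *+ 2)
      - - x ^+ 2 / (sigma ^+ 2 *+ 2) =
     (3 * x ^+ 2 - 2 * l ^+ 2) / (8 * sigma ^+ 2).
    by field.
  apply: divr_ge0; last by lra.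
  have := sqr_ge0 x; lra.
rewrite /normal_prob.
have c0 : 0 <= 2 * c by rewrite mulr_ge0// expR_ge0.
apply: le_trans.
  apply: (@ge0_le_integral _ _ _ mu _ mA (fun x => (normal_pdf 0 sigma x)%:E)
      (fun x => (2 * c)%R%:E * (normal_pdf 0 (2 * sigma)%R x)%:E)%E) => //=.
  - by move=> x _; rewrite lee_fin normal_pdf_ge0.
  - by apply/measurable_EFinP/measurable_funTS; exact: measurable_normal_pdf.
  - apply/measurable_funTS/measurable_EFinP/measurable_funM => //.
    exact: measurable_normal_pdf.
rewrite ge0_integralZl//=; last first.
- by move=> x _; rewrite lee_fin normal_pdf_ge0.
- by apply/measurable_EFinP/measurable_funTS; exact: measurable_normal_pdf.
rewrite -[leRHS]mule1 lee_wpmul2l ?lee_fin//.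
rewrite -(integral_normal_pdf 0 (2 * sigma)).
apply: ge0_subset_integral => //=.
- by apply/measurable_EFinP; exact: measurable_normal_pdf.
- by move=> x _; rewrite lee_fin normal_pdf_ge0.
Qed.

(** The exponential tail is weakened to an arbitrary power, the form that can be
summed against geometric sequences. *)
Lemma normal_prob_tail_le_poly (m : nat) (sigma l : R) : 0 < sigma -> 0 < l ->
  (normal_prob 0 sigma [set x | (l < `|x|)%R]
     <= (2 * (m.+1)`!%:R * (4 * sigma ^+ 2 / l ^+ 2) ^+ m.+1)%:E)%E.
Proof.
move=> s0 l0; apply: le_trans (normal_prob_tail_le s0 (ltW l0)) _.
rewrite lee_fin -mulrA ler_pM2l//.
have y0 : 0 < l ^+ 2 / (4 * sigma ^+ 2).
  by rewrite divr_gt0 ?mulr_gt0 ?exprn_gt0.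
by apply: le_trans (expRN_le m y0) _; rewrite -exprVn invf_div.
Qed.

End normal_bounds.

(** * Almost surely bounded energies *)

Section expected_energy.
Context d (T : measurableType d) (R : realType) (P : probability T R).
Implicit Types (J : set R) (X : R -> {RV P >-> R}) (V : R -> R).

(** Decomposition of the kernel along the dyadic radii 2^j tau: if |y| lies
between two consecutive radii, then g is at least the smaller one. Only
indicators of balls for y remain, and the sum is finite. *)
Lemma riesz_kernel_le (s tau y g : R) (n : nat) : 0 <= s -> 0 < tau ->
  tau <= g -> `|y| <= g ->
  g `^ (- s) <= \sum_(0 <= j < n)
     ((2 ^+ j * tau) `^ s)^-1 * (`|y| <= 2 ^+ j.+1 * tau)%R%:R
   + ((2 ^+ n * tau) `^ s)^-1.
Proof.
move=> s0 tau0 tg yg; have g0 : 0 < g by exact: lt_le_trans tg.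
have small n' : 2 ^+ n' * tau <= g -> g `^ (- s) <= ((2 ^+ n' * tau) `^ s)^-1.
  move=> h; have t0 : 0 < 2 ^+ n' * tau by rewrite mulr_gt0// exprn_gt0.
  rewrite powRN lef_pV2 ?posrE ?powR_gt0//.
  by apply: ge0_ler_powR; rewrite ?nnegrE// ltW.
elim: n => [|n IH].
  by rewrite big_geq// add0r; apply: small; rewrite mul1r.
rewrite big_nat_recr//=; have [yn|ny]/= := leP `|y| (2 ^+ n.+1 * tau).
  by rewrite mulr1n mulr1 (le_trans IH)// lerDl invr_ge0 powR_ge0.
rewrite mulr0n mulr0 addr0 ler_wpDl ?small//; last first.
  by rewrite (le_trans _ yg)// ltW.
by rewrite sumr_ge0// => j _; rewrite mulr_ge0// invr_ge0 powR_ge0.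
Qed.

(** Each ball of radius r has probability at most r / sigma, so the terms of
[riesz_kernel_le] have expectations forming a geometric series of ratio
2^(1 - s), convergent as s > 1. *)
Lemma gaussian_riesz_le (s tau sigma : R) (Y g : T -> R) :
  1 < s -> 0 < tau -> 0 < sigma ->
  measurable_fun setT Y -> measurable_fun setT g ->
  (forall A, measurable A -> P (Y @^-1` A) = normal_prob 0 sigma A) ->
  (forall w, tau <= g w) -> (forall w, `|Y w| <= g w) ->
  (\int[P]_w (g w `^ (- s))%:E
     <= (2 / (1 - 2 `^ (1 - s)) * (tau `^ (1 - s) / sigma) + 1)%:E)%E.
Proof.
move=> s1 tau0 sigma0 mY mg lawY tg Yg.
have s0 : 0 <= s by lra.
(* n makes the largest dyadic radius exceed 1, so the last term of the
   decomposition of the kernel is at most 1 *)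
have [n ntau] : exists n, 1 <= 2 ^+ n * tau.
  exists (Num.truncn tau^-1).+1; rewrite -ler_pdivrMr// div1r.
  apply: (le_trans (ltW (truncnS_gt _))).
  by rewrite -natrX ler_nat ltnW// ltn_expl.
pose A j := Y @^-1` [set y | `|y| <= 2 ^+ j.+1 * tau].
have mball (r : R) : measurable [set y : R | `|y| <= r].
  rewrite (_ : [set y | _] = `[- r, r]%classic)//.
  by apply/seteqP; split => x /=; rewrite in_itv/= ler_norml.
have mA j : measurable (A j) by rewrite -[A j]setTI; exact: mY.
pose c j := ((2 ^+ j * tau) `^ s)^-1.
have c0 j : 0 <= c j by rewrite invr_ge0 powR_ge0.
have PA j : (P (A j) <= (2 ^+ j.+1 * tau / sigma)%:E)%E.
  rewrite lawY//; apply: normal_prob_ball_le => //.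
  by rewrite mulr_ge0 ?exprn_ge0// ltW.
have p1 : 2 `^ (1 - s) < 1 :> R.
  by apply: powR_lt1; rewrite ?ltr1n//; lra.
apply: (@le_trans _ _ (\int[P]_w
    ((\sum_(0 <= j < n) (c j)%:E * (\1_(A j) w)%:E) + 1))%E).
  apply: ge0_le_integral => //=.
  - by move=> w _; rewrite lee_fin powR_ge0.
  - apply/measurable_EFinP.
    exact: (measurableT_comp (measurable_powR (- s))).
  - apply: emeasurable_funD => //; apply: emeasurable_sum => j.
    by apply/measurable_EFinP/measurable_funM => //; exact: measurable_indic.
  - move=> w _; under eq_bigr do rewrite -EFinM.
    rewrite sumEFin -EFinD lee_fin.
    apply: le_trans (riesz_kernel_le n s0 tau0 (tg w) (Yg w)) _.
    apply: lerD.
      apply: ler_sum => j _; rewrite -/(c j) indicE.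
      suff -> : (w \in A j) = (`|Y w| <= 2 ^+ j.+1 * tau) by [].
      by apply/idP/idP => [/set_mem|h]; last exact/mem_set.
    rewrite -[leRHS]invr1 lef_pV2 ?posrE ?powR_gt0 ?(lt_le_trans ltr01)//.
    rewrite -[leLHS](powRr0 (2 ^+ n * tau)).
    exact: ler_powR.
rewrite ge0_integralD//=; last 2 first.
- by move=> w _; apply: sume_ge0 => j _; rewrite -EFinM lee_fin mulr_ge0.
- apply: emeasurable_sum => j.
  by apply/measurable_EFinP/measurable_funM => //; exact: measurable_indic.
rewrite integral_cst//= probability_setT mule1 EFinD leeD2r//.
rewrite ge0_integral_sum//; last 2 first.
- move=> j.
  by apply/measurable_EFinP/measurable_funM => //; exact: measurable_indic.
- by move=> j w _; rewrite -EFinM lee_fin mulr_ge0.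
apply: (@le_trans _ _ (\sum_(0 <= j < n)
    (2 * (tau `^ (1 - s) / sigma) * 2 `^ (1 - s) ^+ j)%:E)%E).
  apply: lee_sum => j _.
  rewrite ge0_integralZl//=; last 2 first.
  - by apply/measurable_EFinP; exact: measurable_indic.
  - by rewrite lee_fin.
  rewrite integral_indic// setIT.
  apply: le_trans (lee_wpmul2l _ (PA j)) _; first by rewrite lee_fin.
  rewrite -EFinM lee_fin le_eqVlt; apply/orP; left; apply/eqP.
  have t0 : 0 < 2 ^+ j * tau by rewrite mulr_gt0// exprn_gt0.
  have -> : 2 `^ (1 - s) ^+ j = (2 ^+ j : R) `^ (1 - s).
    by rewrite exprn_powR.
  have e : (2 ^+ j : R) `^ (1 - s) * tau `^ (1 - s) = c j * (2 ^+ j * tau).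
    rewrite -powRM ?exprn_ge0 ?(ltW tau0)// powRB ?(gt_eqF t0) ?implybT//.
    by rewrite powRr1 ?(ltW t0)// mulrC.
  have -> : 2 * (tau `^ (1 - s) / sigma) * (2 ^+ j) `^ (1 - s) =
    2 / sigma * ((2 ^+ j) `^ (1 - s) * tau `^ (1 - s)) by ring.
  by rewrite e exprS; ring.
rewrite sumEFin lee_fin -mulr_sumr.
have q0 : 0 <= 2 * (tau `^ (1 - s) / sigma).
  by rewrite mulr_ge0// divr_ge0 ?powR_ge0// ltW.
have -> : 2 / (1 - 2 `^ (1 - s)) * (tau `^ (1 - s) / sigma) =
    2 * (tau `^ (1 - s) / sigma) * (1 - 2 `^ (1 - s))^-1 by ring.
apply: ler_wpM2l => //.
by apply: geometric_sum_le; rewrite ?powR_gt0.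
Qed.

(** Fatou's lemma: the lower limit of u has a finite integral. *)
Lemma ae_frequently_bounded (u : nat -> T -> R) (L : R) :
  (forall n, measurable_fun setT (u n)) -> (forall n w, 0 <= u n w) ->
  (forall n, (\int[P]_w (u n w)%:E <= L%:E)%E) ->
  {ae P, forall w, exists L', forall n0, exists2 n, (n0 <= n)%N & u n w <= L'}.
Proof.
move=> mu u0 uL; pose f n w := (u n w)%:E.
have mf n : measurable_fun setT (f n) by exact/measurable_EFinP.
have f0 n w : setT w -> (0 <= f n w)%E by rewrite lee_fin.
have f0' w : (0 <= limn_einf (f^~ w))%E.
  rewrite limn_einf_lim; apply: lime_ge; first exact: is_cvg_einfs.
  by apply: nearW => n; apply: le_ereal_inf_tmp => _ [m _ <-]; exact: f0 I.
have mlim : measurable_fun setT (fun w => limn_einf (f^~ w)).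
  rewrite (_ : (fun w => _) = (fun w => - limn_esup (fun n => - f n w)))%E.
    apply: measurableT_comp => //; apply: measurable_fun_limn_esup => n.
    exact: measurableT_comp.
  by apply/funext => w; rewrite (limn_esupN (f^~ w)) oppeK.
have intlim : (\int[P]_w limn_einf (f^~ w) < +oo)%E.
  apply: le_lt_trans (fatou P measurableT mf f0) _.
  apply: (@le_lt_trans _ _ L%:E); last by rewrite ltry.
  rewrite limn_einf_lim; apply: lime_le; first exact: is_cvg_einfs.
  apply: nearW => n; apply: ge_ereal_inf; exists (\int[P]_w f n w)%E => //.
    by exists n => /=.
  exact: uL.
have : P.-integrable setT (fun w => limn_einf (f^~ w)).
  apply/integrableP; split; first exact: mlim.
  rewrite (eq_integral (fun w => limn_einf (f^~ w))); first exact: intlim.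
  by move=> w _; rewrite gee0_abs.
move=> /(integrable_ae measurableT); apply: filterS => w /(_ I) fin.
apply: contrapT => /forallNP h.
suff /cvg_limn_einf_sup[e _] : f^~ w @ \oo --> +oo%E by rewrite e in fin.
apply/cvgeyPge => A; have /existsNP[n0 hn0] := h A.
exists n0 => // n /= nn0; rewrite lee_fin; apply: contrapT => /negP.
rewrite -ltNge => un; apply: hn0; exists n => //; exact: ltW.
Qed.

(** The strict inequality keeps [normal_prob] away from the standard deviation
0, for which it is the uniform law on the unit interval. *)
Definition gaussian_increments J X V : Prop :=
  forall s t, J s -> J t -> s < t -> V s < V t /\
    forall A : set R, measurable A ->
      P [set w | A (X t w - X s w)] = normal_prob 0 (Num.sqrt (V t - V s)) A.

Lemma measurable_edist_graph X (t u : R) :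
  measurable_fun setT (fun w => edist (t, X t w) (u, X u w)).
Proof.
rewrite /Defs.edist/=; apply: measurableT_comp.
  exact: (continuous_measurable_fun (@sqrt_continuous R)).
apply: measurable_funD => //; apply: measurable_funX.
by apply: measurable_funB.
Qed.

Lemma measurable_grid_energy X (s a b : R) (n : nat) :
  measurable_fun setT (fun w => grid_energy s a b (fun t => X t w) n).
Proof.
rewrite /grid_energy; apply: measurable_funM => //.
apply: measurable_sum => k; apply: measurable_sum => j.
under eq_fun do rewrite -powRN.
apply: (measurableT_comp (measurable_powR (- s))).
exact: measurable_edist_graph.
Qed.

Lemma expected_grid_energy_le J X V (s alpha a b : R) :
  gaussian_increments J X V -> 1 < s -> 0 <= alpha -> s - 1 + alpha / 2 < 1 ->
  a < b -> `[a, b]%classic `<=` J ->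
  (forall u v, u \in `[a, b] -> v \in `[a, b] -> u < v ->
     (v - u) `^ alpha <= V v - V u) ->
  exists L, forall n,
    (\int[P]_w (grid_energy s a b (fun t => X t w) n)%:E <= L%:E)%E.
Proof.
move=> gX s1 al0 beta1 ab abJ hV; set beta := s - 1 + alpha / 2 in beta1.
have beta0 : 0 <= beta by rewrite /beta addr_ge0 ?subr_ge0 ?(ltW s1)// divr_ge0.
have [C _ hC] := grid_sum_le beta0 beta1 ab.
pose K : R := 2 / (1 - 2 `^ (1 - s)).
have K0 : 0 <= K.
  have : 2 `^ (1 - s) < 1 :> R.
    by apply: powR_lt1; rewrite ?ltr1n//; lra.
  by move=> h; rewrite divr_ge0// subr_ge0 ltW.
(* The Gaussian estimate turns the kernel of exponent s into that of exponent
   beta < 1, whose grid sums are bounded. *)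
exists (K * C + 1) => n; set M : R := 2 ^+ n.
have M0 : 0 < M by rewrite exprn_gt0.
pose D j k w := edist (grid a b n j, X (grid a b n j) w)
                      (grid a b n k, X (grid a b n k) w).
have mD j k : measurable_fun setT (fun w => (D j k w `^ (- s))%:E).
  apply/measurable_EFinP; apply: (measurableT_comp (measurable_powR (- s))).
  exact: measurable_edist_graph.
have D0 j k w : (0 <= (D j k w `^ (- s))%:E)%E by rewrite lee_fin powR_ge0.
have one j k : (j < k)%N -> (k < 2 ^ n)%N ->
    (\int[P]_w (D j k w `^ (- s))%:E <=
      (K * ((grid a b n k - grid a b n j) `^ beta)^-1 + 1)%:E)%E.
  move=> jk kn.
  have gj : grid a b n j \in `[a, b].
    exact: grid_itv (ltW ab) (ltnW (ltn_trans jk kn)).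
  have gk : grid a b n k \in `[a, b] by exact: grid_itv (ltW ab) (ltnW kn).
  have glt := grid_lt n ab jk; set tau := grid a b n k - grid a b n j.
  have tau0 : 0 < tau by rewrite subr_gt0.
  have [Vlt law] := gX _ _ (abJ _ gj) (abJ _ gk) glt.
  have V0 : 0 < V (grid a b n k) - V (grid a b n j) by rewrite subr_gt0.
  have sig0 : 0 < Num.sqrt (V (grid a b n k) - V (grid a b n j)).
    by rewrite sqrtr_gt0.
  apply: (le_trans (@gaussian_riesz_le s tau _
    (fun w => X (grid a b n k) w - X (grid a b n j) w) (D j k) s1 tau0 sig0
    _ _ law _ _)).
  - by apply: measurable_funB.
  - exact: measurable_edist_graph.
  - move=> w; apply: le_trans (edist_ge_fst _ _) => /=.
    by rewrite distrC ler_norm.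
  - by move=> w; rewrite distrC; exact: le_trans (edist_ge_snd _ _).
  rewrite lee_fin lerD2r -/K ler_wpM2l//.
  (* the standard deviation is at least tau ^ (alpha / 2) *)
  have -> : (tau `^ beta)^-1 = tau `^ (1 - s) / tau `^ (alpha / 2).
    by rewrite -!powRN -powRD ?(gt_eqF tau0) ?implybT//; congr powR;
      rewrite /beta; ring.
  rewrite ler_wpM2l ?powR_ge0// lef_pV2 ?posrE ?powR_gt0//.
  rewrite powRrM powR12_sqrt ?powR_ge0// ler_sqrt ?(ltW V0)//.
  exact: hV.
have -> : (fun w => (grid_energy s a b (fun t => X t w) n)%:E) =
    (fun w => (\sum_(0 <= k < 2 ^ n) \sum_(0 <= j < k)
       (D j k w `^ (- s))%:E) * ((M ^+ 2)^-1)%:E)%E.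
  apply/funext => w; rewrite /grid_energy EFinM -sumEFin; congr (_ * _)%E.
  apply: eq_bigr => k _; rewrite -sumEFin; apply: eq_bigr => j _.
  by rewrite powRN.
rewrite ge0_integralZr//=; last 3 first.
- by apply: emeasurable_sum => k; apply: emeasurable_sum => j; exact: mD.
- by move=> w _; apply: sume_ge0 => k _; apply: sume_ge0 => j _; exact: D0.
- by rewrite lee_fin invr_ge0 exprn_ge0// ltW.
rewrite ge0_integral_sum//; last 2 first.
- by move=> k; apply: emeasurable_sum => j; exact: mD.
- by move=> k w _; apply: sume_ge0 => j _; exact: D0.
apply: (@le_trans _ _ ((\sum_(0 <= k < 2 ^ n) \sum_(0 <= j < k)
    (K * ((grid a b n k - grid a b n j) `^ beta)^-1 + 1)%:E) *
    (M ^+ 2)^-1%:E)%E).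
  apply: lee_wpmul2r; first by rewrite lee_fin invr_ge0 exprn_ge0// ltW.
  rewrite !big_seq; apply: lee_sum => k; rewrite mem_index_iota => /andP[_ kn].
  rewrite ge0_integral_sum//.
  rewrite !big_seq; apply: lee_sum => j; rewrite mem_index_iota => /andP[_ jk].
  exact: one.
under eq_bigr do rewrite sumEFin.
rewrite sumEFin -EFinM lee_fin ler_pdivrMr ?exprn_gt0// mulrDl mul1r.
under eq_bigr do rewrite big_split/= -mulr_sumr.
rewrite big_split/= -mulr_sumr; apply: lerD.
  by rewrite -[leRHS]mulrA; apply: ler_wpM2l => //; exact: hC.
apply: (@le_trans _ _ (\sum_(0 <= k < 2 ^ n) M)).
  apply: ler_sum_nat => k /andP[_ kn].
  by rewrite sumr_const_nat subn0 /M -natrX ler_nat ltnW.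
by rewrite sumr_const_nat subn0 -mulr_natl natrX expr2.
Qed.

Lemma ae_hausdorff_measure_gt0 J X V (s alpha a b : R) :
  gaussian_increments J X V -> continuous_paths J X ->
  1 < s -> 0 <= alpha -> s - 1 + alpha / 2 < 1 ->
  a < b -> `[a, b]%classic `<=` J ->
  (forall u v, u \in `[a, b] -> v \in `[a, b] -> u < v ->
     (v - u) `^ alpha <= V v - V u) ->
  {ae P, forall w, hausdorff_measure s (graph_on (fun t => X t w) J) <> 0%E}.
Proof.
move=> gX cX s1 al0 beta1 ab abJ hV.
have [L hL] := expected_grid_energy_le gX s1 al0 beta1 ab abJ hV.
have bd := ae_frequently_bounded (measurable_grid_energy X s a b)
  (fun n w => grid_energy_ge0 s a b _ n) hL.
move: bd cX; apply: filterS2 => w [L' hL'] cw.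
have /(@hausdorff_measure_gt0_of_energy _ s a b L') : 0 < s by lra.
move=> /(_ (fun t => X t w) ab) h /hausdorff_measure_eq0_subset H.
apply: h => //; first exact: continuous_subspaceW cw.
by apply: H => _ [t abt <-]; exists t => //; exact: abJ.
Qed.

End expected_energy.

(** * Covering graphs of controlled oscillation *)

Section coverings.
Context {R : realType}.

(** At level n the graph is covered by 2^n * O(2^(n (1 - gamma))) sets of
diameter O(2^(-n)), of total power O(2^(n (2 - gamma - s))). *)
Lemma hausdorff_measure_graph_eq0 (f : R -> R) (a b gamma s C : R) (n0 : nat) :
  a < b -> 0 <= gamma -> gamma <= 1 -> 2 - gamma < s -> 0 <= C ->
  (forall n k t, (n0 <= n)%N -> (k < 2 ^ n)%N ->
     t \in `[grid a b n k, grid a b n k.+1] ->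
     `|f t - f (grid a b n k)| <= C * (2 ^+ n) `^ (- gamma)) ->
  hausdorff_measure s (graph_on f `[a, b]) = 0%E.
Proof.
move=> ab g0 g1 gs C0 osc; have ba : 0 < b - a by rewrite subr_gt0.
apply: hausdorff_measure_eq0_of_finite_covers => [|e eps e0 eps0]; first lra.
have p1 : 2 `^ (2 - gamma - s) < 1 :> R.
  by apply: powR_lt1; rewrite ?ltr1n//; lra.
have [n1 hn1] := geometric_eventually_le
  ((b - a + 1) `^ s * (2 * C + 1)) (powR_ge0 _ _) p1 eps0.
have [||n2 hn2] := @geometric_eventually_le R (b - a + 1) 2^-1 e _ _ e0.
- by rewrite invr_ge0.
- by rewrite invf_lt1// ltr1n.
pose n := maxn n0 (maxn n1 n2).
have nn0 : (n0 <= n)%N by rewrite leq_maxl.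
have nn1 : (n1 <= n)%N by rewrite !leq_max leqnn orbT.
have nn2 : (n2 <= n)%N by rewrite !leq_max leqnn !orbT.
set M : R := 2 ^+ n.
have M0 : 0 < M by rewrite exprn_gt0.
have M1 : 1 <= M by rewrite exprn_ege1// ler1n.
pose L := (Num.truncn (2 * C * M `^ (1 - gamma))).+1.
have MV : M * M `^ (- gamma) = M `^ (1 - gamma).
  by rewrite powRD ?(gt_eqF M0) ?implybT// powRr1// ltW.
have Mg1 : 1 <= M `^ (1 - gamma).
  by rewrite -[leLHS](powRr0 M); apply: ler_powR => //; rewrite subr_ge0.
have LM : L%:R <= (2 * C + 1) * M `^ (1 - gamma).
  rewrite mulrDl mul1r /L -natr1; apply: lerD => //.
  by rewrite truncn_le !mulr_ge0 ?powR_ge0.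
(* The cell number k is covered by L squares stacked from the lowest possible
   value of f on; the index i encodes the pair (k, l). *)
pose U i := [set p : R * R | let k := (i %/ L)%N in let l := (i %% L)%N in
  p.1 \in `[grid a b n k, grid a b n k.+1] /\
  (p.2 - f (grid a b n k) + C * M `^ (- gamma)) * M \in `[l%:R, l.+1%:R]].
exists (2 ^ n * L)%N, ((b - a + 1) / M), U; split.
- by have := hn2 n nn2; rewrite exprVn.
- have -> : ((b - a + 1) / M) `^ s = (b - a + 1) `^ s * M `^ (- s).
    rewrite powRM ?invr_ge0 ?(ltW M0)//; last by lra.
    congr *%R.
    by rewrite powRN -powR_inv1 ?(ltW M0)// powRAC powR_inv1 ?powR_ge0.
  have H := hn1 n nn1.
  rewrite -exprn_powR// -/M in H; apply: le_trans H.
  rewrite natrM natrX -/M.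
  have -> : M `^ (2 - gamma - s) = M * M `^ (1 - gamma) * M `^ (- s).
    rewrite -[X in X * _ * _](powRr1 (ltW M0)).
    by rewrite -!powRD ?(gt_eqF M0) ?implybT//; congr powR; ring.
  have h1 : 0 <= (b - a + 1) `^ s by exact: powR_ge0.
  have h2 : 0 <= M `^ (- s) by exact: powR_ge0.
  have h3 : 0 <= M * ((b - a + 1) `^ s * M `^ (- s)).
    by rewrite mulr_ge0 ?(ltW M0)// mulr_ge0.
  by have := ler_wpM2l h3 LM; nra.
- move=> _ [t abt <-] /=.
  have [k kn tk] := exists_grid_cell n ab abt.
  have := osc n k t nn0 kn tk; rewrite -/M ler_norml => /andP[lo hi].
  pose y := (f t - f (grid a b n k) + C * M `^ (- gamma)) * M.
  have y0 : 0 <= y by rewrite mulr_ge0 ?(ltW M0)//; lra.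
  have yL : y <= 2 * C * M `^ (1 - gamma).
    by rewrite /y -MV; have := ler_wpM2r (ltW M0) hi; nra.
  have lL : (Num.truncn y < L)%N by rewrite ltnS le_truncn.
  exists (k * L + Num.truncn y)%N.
    apply: (@leq_trans (k.+1 * L)); last by rewrite leq_mul2r kn orbT.
    by rewrite mulSnr ltn_add2l.
  rewrite /U/= divnMDl// divn_small// addn0 modnMDl modn_small//; split => //.
  rewrite -/y in_itv/=; have /andP[-> h] := truncn_itv y0.
  exact: ltW.
- move=> i p q _ [px p2] [qx q2]; apply: (le_trans (edist_le_add _ _)).
  rewrite mulrDl; apply: lerD.
    move: px qx; rewrite !in_itv/= => /andP[pl pu] /andP[ql qu].
    have := gridBS a b n (i %/ L); rewrite -/M => h.
    by rewrite ler_norml; apply/andP; split; lra.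
  move: p2 q2; rewrite !in_itv/= -natr1 => /andP[pl pu] /andP[ql qu].
  rewrite ler_pdivlMr// -[X in _ * X](gtr0_norm M0) -normrM ler_norml.
  by apply/andP; split; lra.
Qed.

(** The case gamma = 0 of [hausdorff_measure_graph_eq0]: a continuous
function on a segment is bounded. *)
Lemma hausdorff_measure_gt2_eq0 (f : R -> R) (a b s : R) :
  a < b -> {within `[a, b], continuous f} -> 2 < s ->
  hausdorff_measure s (graph_on f `[a, b]) = 0%E.
Proof.
move=> ab cf s2.
have [c _ hc] := EVT_max (ltW ab) cf.
have [e _ he] := EVT_min (ltW ab) cf.
have g2 : 2 - 0 < s by rewrite subr0.
apply: (@hausdorff_measure_graph_eq0 f a b 0 s `|f c - f e| 0%N) => //.
move=> n k t _ kn tk; rewrite oppr0 powRr0 mulr1.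
have gk : grid a b n k \in `[a, b] by exact: grid_itv (ltW ab) (ltnW kn).
have gk1 : grid a b n k.+1 \in `[a, b] by exact: grid_itv (ltW ab) kn.
have tab : t \in `[a, b].
  move: tk gk gk1; rewrite !in_itv/= => /andP[t1 t2] /andP[u1 _] /andP[_ u2].
  by rewrite (le_trans u1 t1) (le_trans t2 u2).
have := hc _ gk; have := hc _ tab.
have := he _ gk; have := he _ tab => h1 h2 h3 h4.
rewrite (@ger0_norm _ (f c - f e)); last by lra.
by rewrite ler_norml; apply/andP; split; lra.
Qed.

(** A grid point of level n + p in a cell of level n is reached from the left
end of the cell by at most one increment of each level n, ..., n + p, which
gives a geometric sum; other points follow by continuity. *)
Lemma dyadic_chaining (f : R -> R) (a b gamma : R) (n0 : nat) :
  a < b -> 0 < gamma -> {within `[a, b], continuous f} ->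
  (forall n k, (n0 <= n)%N -> (k < 2 ^ n)%N ->
     `|f (grid a b n k.+1) - f (grid a b n k)| <= (2 ^+ n) `^ (- gamma)) ->
  forall n k t, (n0 <= n)%N -> (k < 2 ^ n)%N ->
     t \in `[grid a b n k, grid a b n k.+1] ->
     `|f t - f (grid a b n k)|
       <= (1 - 2 `^ (- gamma))^-1 * (2 ^+ n) `^ (- gamma).
Proof.
move=> ab g0 cf inc n k t nn0 kn tk.
set r : R := 2 `^ (- gamma); have r0 : 0 < r by exact: powR_gt0.
have r1 : r < 1.
  by apply: powR_lt1; rewrite ?ltr1n ?oppr_lt0.
have {}inc m l : (n0 <= m)%N -> (l < 2 ^ m)%N ->
    `|f (grid a b m l.+1) - f (grid a b m l)| <= r ^+ m.
  by rewrite -exprn_powR//; exact: inc.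
rewrite exprn_powR// -/r.
set a' := grid a b n k; set b' := grid a b n k.+1.
have a'b' : a' < b' by exact: grid_lt.
(* One new increment at each level, by halving the index j. *)
have chain p j : (j <= 2 ^ p)%N ->
    `|f (grid a' b' p j) - f a'| <= \sum_(0 <= i < p.+1) r ^+ (n + i).
  elim: p j => [|p IH] j.
    rewrite expn0 big_nat1 addn0; case: j => [|[|//]] _.
      by rewrite grid0 subrr normr0 exprn_ge0// ltW.
    by rewrite (grid_max a' b' 0); exact: inc.
  move=> jp; have IH' : (j./2 <= 2 ^ p)%N.
    by rewrite leq_half_double -mul2n -expnS ltnW.
  have evE : grid a' b' p.+1 (j./2).*2 = grid a' b' p j./2.
    rewrite /grid exprS -muln2 natrM.
    have : (2 ^+ p : R) != 0 by rewrite expf_neq0.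
    by move: (2 ^+ p : R) => u u0; field.
  rewrite big_nat_recr//=.
  have [jo|je] := boolP (odd j); last first.
    rewrite -(odd_double_half j) (negbTE je) add0n evE.
    by rewrite (le_trans (IH _ IH'))// lerDl exprn_ge0// ltW.
  rewrite -(odd_double_half j) jo add1n.
  have -> : f (grid a' b' p.+1 (j./2).*2.+1) - f a' =
      (f (grid a' b' p.+1 (j./2).*2.+1) - f (grid a' b' p.+1 (j./2).*2))
      + (f (grid a' b' p j./2) - f a') by rewrite evE; ring.
  apply: (le_trans (ler_normD _ _)); rewrite [leLHS]addrC.
  apply: lerD; first exact: IH.
  rewrite !grid_grid (addnS (k * _)).
  apply: inc; first by rewrite (leq_trans nn0)// leq_addr.
  rewrite expnD (@leq_trans (k.+1 * 2 ^ p.+1))//.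
    rewrite mulSn addnC -addSn leq_add2r.
    by rewrite -(odd_double_half j) jo add1n in jp.
  by rewrite leq_mul2r kn orbT.
have sum_le p : \sum_(0 <= i < p.+1) r ^+ (n + i) <= (1 - r)^-1 * r ^+ n.
  under eq_bigr do rewrite exprD.
  rewrite -mulr_sumr mulrC ler_pM2r ?exprn_gt0//.
  exact: geometric_sum_le.
apply/ler_addgt0Pr => e e0.
have sub u : u \in `[a', b'] -> u \in `[a, b].
  rewrite !in_itv/= => /andP[u1 u2].
  have := grid_itv (ltW ab) (ltnW kn); have := grid_itv (ltW ab) kn.
  rewrite !in_itv/= -/a' -/b' => /andP[_ h1] /andP[h2 _].
  by rewrite (le_trans h2 u1) (le_trans u2 h1).
have /nbhs_ballP[dl /= dl0 hdl] := within_continuous_near cf (sub _ tk) e0.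
have dl20 : 0 < dl / 2 by rewrite divr_gt0.
have [||p0 hp] := @geometric_eventually_le R (b' - a') 2^-1 (dl / 2) _ _ dl20.
- by rewrite invr_ge0.
- by rewrite invf_lt1// ltr1n.
have [j jp tj] := exists_grid_cell p0 a'b' tk.
have gj : grid a' b' p0 j \in `[a', b'] by exact: grid_itv (ltW a'b') (ltnW jp).
have close : `|t - grid a' b' p0 j| < dl.
  have := hp p0 (leqnn _); rewrite exprVn => h.
  have h' := gridBS a' b' p0 j.
  move: tj; rewrite in_itv/= => /andP[t1 t2].
  by rewrite ger0_norm ?subr_ge0//; lra.
have h1 := hdl _ close (sub _ gj).
have h2 := le_trans (chain p0 j (ltnW jp)) (sum_le p0).
have -> : f t - f a' =
    (f (grid a' b' p0 j) - f a') + (f t - f (grid a' b' p0 j)).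
  by ring.
by rewrite (le_trans (ler_normD _ _))// lerD// ltW.
Qed.

End coverings.

(** * Oscillation of the paths *)

Section ae_increments.
Context d (T : measurableType d) (R : realType) (P : probability T R).
Implicit Types (J : set R) (X : R -> {RV P >-> R}) (V : R -> R).

(** Borel--Cantelli. The variance of an increment of level n is O(2^(-n alpha)),
smaller than the square 2^(-2 n gamma) of the threshold by a geometric factor;
a high power of this factor also absorbs the 2^n increments of the level. *)
Lemma ae_increments_le J X V (a b alpha gamma C : R) :
  gaussian_increments J X V -> a < b -> `[a, b]%classic `<=` J ->
  0 < C -> 2 * gamma < alpha ->
  (forall u v, u \in `[a, b] -> v \in `[a, b] -> u < v ->
     V v - V u <= C * (v - u) `^ alpha) ->
  {ae P, forall w, exists n0, forall n k, (n0 <= n)%N -> (k < 2 ^ n)%N ->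
     `|X (grid a b n k.+1) w - X (grid a b n k) w| <= (2 ^+ n) `^ (- gamma)}.
Proof.
move=> gX ab abJ C0 ga hV; have ba : 0 < b - a by rewrite subr_gt0.
pose p : R := 2 `^ (2 * gamma - alpha).
have p0 : 0 < p by exact: powR_gt0.
have p1 : p < 1.
  by apply: powR_lt1; rewrite ?ltr1n//; lra.
(* a moment high enough to beat the number of dyadic intervals *)
have [m hm] : exists m, p ^+ m.+1 <= 4^-1.
  have [|m hm] := @geometric_eventually_le R 1 p 4^-1 (ltW p0) p1; first lra.
  by exists m; have := hm m.+1 (leqnSn m); rewrite mul1r.
pose E n k := [set w | (2 ^+ n) `^ (- gamma) <
   `|X (grid a b n k.+1) w - X (grid a b n k) w|].
pose K := 2 * (m.+1)`!%:R * (4 * (C * (b - a) `^ alpha)) ^+ m.+1.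
have K0 : 0 <= K.
  by rewrite !mulr_ge0// exprn_ge0// !mulr_ge0 ?powR_ge0// ltW.
have mball (l : R) : measurable [set y : R | l < `|y|].
  rewrite (_ : [set y | _] = ~` `[- l, l]%classic); first exact: measurableC.
  by apply/seteqP; split => x /=; rewrite in_itv/= -ler_norml ltNge => /negP.
have mE n k : measurable (E n k).
  rewrite -[E n k]setTI.
  have : measurable_fun setT
      (fun w => X (grid a b n k.+1) w - X (grid a b n k) w).
    exact: measurable_funB.
  by move=> /(_ measurableT _ (mball ((2 ^+ n) `^ (- gamma)))).
have PE n k : (k < 2 ^ n)%N -> (P (E n k) <= (K * (4^-1) ^+ n)%:E)%E.
  move=> kn; have M0 : 0 < 2 ^+ n :> R by rewrite exprn_gt0.
  have gk : grid a b n k \in `[a, b] by exact: grid_itv (ltW ab) (ltnW kn).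
  have gk1 : grid a b n k.+1 \in `[a, b] by exact: grid_itv (ltW ab) kn.
  have glt := grid_lt n ab (ltnSn k).
  have [Vlt law] := gX _ _ (abJ _ gk) (abJ _ gk1) glt.
  have V0 : 0 < V (grid a b n k.+1) - V (grid a b n k) by rewrite subr_gt0.
  have l0 : 0 < (2 ^+ n : R) `^ (- gamma) by exact: powR_gt0.
  rewrite (_ : E n k = [set w | [set y | (2 ^+ n) `^ (- gamma) < `|y|]
      (X (grid a b n k.+1) w - X (grid a b n k) w)])//.
  rewrite law//; apply: le_trans (normal_prob_tail_le_poly m _ l0) _.
    by rewrite sqrtr_gt0.
  rewrite lee_fin /K -[leRHS]mulrA.
  apply: ler_wpM2l; first by rewrite mulr_ge0.
  rewrite sqr_sqrtr ?(ltW V0)//.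
  have q : (4 * (V (grid a b n k.+1) - V (grid a b n k)) /
      (2 ^+ n) `^ (- gamma) ^+ 2) <= 4 * (C * (b - a) `^ alpha) * p ^+ n.
    have -> : p ^+ n = (2 ^+ n) `^ (- alpha) / (2 ^+ n) `^ (- gamma) ^+ 2.
      rewrite -[X in _ = _ / X]powR_mulrn ?powR_ge0// -powRrM -powRB.
        by rewrite exprn_powR//; congr (_ `^ _ ^+ n); ring.
      by rewrite (gt_eqF M0) implybT.
    rewrite [leRHS]mulrA ler_pM2r ?invr_gt0 ?exprn_gt0//.
    rewrite -[leRHS]mulrA ler_pM2l//.
    apply: le_trans (hV _ _ gk gk1 glt) _.
    rewrite gridBS powRM ?invr_ge0 ?(ltW M0) ?(ltW ba)// -!mulrA ler_pM2l//.
    by rewrite -powR_inv1 ?(ltW M0)// -powRrM mulN1r.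
  have q0 : 0 <= 4 * (V (grid a b n k.+1) - V (grid a b n k)) /
      (2 ^+ n) `^ (- gamma) ^+ 2.
    by rewrite divr_ge0 ?exprn_ge0 ?powR_ge0// mulr_ge0// ltW.
  apply: (@le_trans _ _ ((4 * (C * (b - a) `^ alpha) * p ^+ n) ^+ m.+1)).
    by rewrite lerXn2r ?nnegrE// (le_trans q0 q).
  rewrite exprMn; apply: ler_wpM2l.
    by rewrite exprn_ge0// !mulr_ge0 ?powR_ge0// ltW.
  by rewrite exprAC lerXn2r ?nnegrE// ?exprn_ge0 ?invr_ge0// ltW.
pose F n := \big[setU/set0]_(k < 2 ^ n) E n k.
have mF n : measurable (F n) by apply: bigsetU_measurable => k _; exact: mE.
have PF n : (P (F n) <= (2 * K / (2 ^ n.+1)%:R)%:E)%E.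
  have := @content_subadditive _ _ _ P (F n) (E n) (2 ^ n)%N
    (fun k _ => mE n k) (mF n) (@subset_refl _ _).
  move=> /le_trans; apply.
  apply: (@le_trans _ _ (\sum_(k < 2 ^ n) (K * 4^-1 ^+ n)%:E)%E).
    by apply: lee_sum => k _; exact: PE.
  rewrite sumEFin lee_fin sumr_const card_ord -[leLHS]mulr_natl !natrX exprVn.
  have -> : (4 : R) = 2 * 2 by rewrite -natrM.
  rewrite exprMn exprS le_eqVlt; apply/orP; left; apply/eqP.
  have : (2 ^+ n : R) != 0 by rewrite expf_neq0.
  by move: (2 ^+ n : R) => u u0; field.
have sF : (\sum_(n <oo) P (F n) < +oo)%E.
  apply: (@le_lt_trans _ _ (2 * K)%:E); last exact: ltry.
  apply: le_trans (epsilon_trick0 xpredT _); last by rewrite mulr_ge0.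
  by apply: lee_nneseries => // n _; exact: PF.
have := lim_sup_set_cvg0 mF sF.
have mL : measurable (lim_sup_set F).
  by apply: bigcapT_measurable => n; apply: bigcup_measurable => j _; exact: mF.
move=> /(negligibleP _ mL) neg.
apply: negligibleS neg => w /= hw n _; apply: contrapT => hn; apply: hw.
exists n => i k ni ki; rewrite leNgt; apply/negP => h; apply: hn.
by exists i => //=; rewrite /F -bigcup_mkord; exists k.
Qed.

Lemma ae_hausdorff_measure_eq0_itv J X V (a b alpha C s : R) :
  gaussian_increments J X V -> continuous_paths J X ->
  a < b -> `[a, b]%classic `<=` J ->
  0 < C -> alpha <= 1 -> s <= 2 -> 2 - alpha / 2 < s ->
  (forall u v, u \in `[a, b] -> v \in `[a, b] -> u < v ->
     V v - V u <= C * (v - u) `^ alpha) ->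
  {ae P, forall w,
     hausdorff_measure s (graph_on (fun t => X t w) `[a, b]) = 0%E}.
Proof.
move=> gX cX ab abJ C0 al1 s2 als hV.
pose gamma := (2 - s + alpha / 2) / 2.
have g0 : 0 < gamma by rewrite /gamma; lra.
have g1 : gamma <= 1 by rewrite /gamma; lra.
have gs : 2 - gamma < s by rewrite /gamma; lra.
have ga : 2 * gamma < alpha by rewrite /gamma; lra.
have inc := ae_increments_le gX ab abJ C0 ga hV.
move: inc cX; apply: filterS2 => w [n0 hn0] cw.
apply: (hausdorff_measure_graph_eq0 ab (ltW g0) g1 gs); last first.
  apply: (dyadic_chaining ab g0 _ hn0).
  exact: continuous_subspaceW cw.
rewrite invr_ge0 subr_ge0.
by apply/ltW/powR_lt1; rewrite ?ltr1n ?oppr_lt0.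
Qed.

End ae_increments.

(** * Local exponents of the variance *)

Section local_exponents_bounds.
Context {R : realType}.
Implicit Types (J : set R) (V : R -> R).

(** The segment lies to the right of t, or to its left if t = S. *)
Lemma time_interval_nbhd_segment (S : \bar R) (t e : R) : (0 < S)%E ->
  time_interval S t -> 0 < e -> exists a b : R, [/\ a < b,
    `[a, b]%classic `<=` time_interval S &
    forall u, u \in `[a, b] -> u \in `]t - e, t + e[].
Proof.
move=> S0 [t0 tS] e0; have [tlt|tge] := ltP t%:E S.
  have [r r0 rS] : exists2 r, 0 < r & ((t + r)%:E <= S)%E.
    case: S S0 tS tlt => [S| |]//= S0 tS tlt.
      by exists (S - t); [rewrite subr_gt0|rewrite subrKC].
    by exists 1 => //; rewrite leey.
  have m0 : 0 < Num.min r (e / 2) by rewrite lt_min r0 divr_gt0.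
  have [mr me] : Num.min r (e / 2) <= r /\ Num.min r (e / 2) <= e / 2.
    by split; rewrite ge_min lexx ?orbT.
  exists t, (t + Num.min r (e / 2)); split.
  - by rewrite ltrDl.
  - move=> u /=; rewrite in_itv/= => /andP[tu ur]; split.
      exact: le_trans tu.
    by apply: le_trans rS; rewrite lee_fin (le_trans ur)// lerD2l.
  - by move=> u; rewrite !in_itv/= => /andP[tu ur]; apply/andP; split; lra.
have t1 : 0 < t by rewrite -lte_fin (lt_le_trans S0).
have m0 : 0 < Num.min t (e / 2) by rewrite lt_min t1 divr_gt0.
have [mt me] : Num.min t (e / 2) <= t /\ Num.min t (e / 2) <= e / 2.
  by split; rewrite ge_min lexx ?orbT.
exists (t - Num.min t (e / 2)), t; split.
- by rewrite ltrBlDr ltrDl.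
- move=> u /=; rewrite in_itv/= => /andP[ru ut]; split; first lra.
  by apply: le_trans tS; rewrite lee_fin.
- by move=> u; rewrite !in_itv/= => /andP[ru ut]; apply/andP; split; lra.
Qed.

Lemma ereal_sup_cvg0_lt1 (T : Type) (A : R -> set T) (F : T -> R) :
  ereal_sup [set (F u)%:E | u in A delta] @[delta --> 0^'+] --> 0%E ->
  exists2 delta, 0 < delta < 1 & forall u, A delta u -> F u < 1.
Proof.
move=> h.
have h1 : \forall delta \near 0^'+,
    (ereal_sup [set (F u)%:E | u in A delta] < 1%:E)%E.
  have lt01 : (0%:E < 1%:E :> \bar R)%E by rewrite lte_fin.
  exact: (h _ (open_ereal_lt' lt01)).
have [delta [[d0 d1] hd]] := filter_ex (filterI (filterI
  (nbhs_right_gt 0) (nbhs_right_lt ltr01)) h1).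
exists delta; first by rewrite d0.
move=> u Au; rewrite -lte_fin; apply: le_lt_trans hd.
by apply: ereal_sup_ubound; exists u.
Qed.

(** Here delta is half the length of the interval I(t, delta'), on which the
ratio of the definition is less than 1. *)
Lemma alpha_lower_lt J V (c : R) :
  (forall s t, J s -> J t -> s < t -> V s < V t) ->
  (alpha_lower J V < c%:E)%E ->
  exists t alpha delta, [/\ J t, 0 <= alpha < c, 0 < delta &
    forall u v, J u -> J v -> u \in `]t - delta, t + delta[ ->
      v \in `]t - delta, t + delta[ -> u < v ->
      (v - u) `^ alpha <= V v - V u].
Proof.
move=> Vi /ereal_inf_lt[_ [t Jt <-]] /ereal_inf_lt[_ [a [a0 ha] <-]].
rewrite lte_fin => ac; have [e /andP[e0 _] he] := ereal_sup_cvg0_lt1 ha.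
exists t, a, (e / 2); split => //; [by rewrite a0|by rewrite divr_gt0|].
move=> u v Ju Jv ut vt uv; have Vuv := Vi _ _ Ju Jv uv.
have := he (v, u); rewrite /distinct_pairs/= !gtr0_norm ?subr_gt0//.
rewrite ltr_pdivrMr ?subr_gt0// mul1r => h; apply/ltW/h.
by split => //; rewrite gt_eqF.
Qed.

(** A ratio less than 1 for some exponent above c gives the bound for c, as
distances are less than 1. *)
Lemma alpha_upper_gt J V (c t : R) :
  (forall s t, J s -> J t -> s < t -> V s < V t) ->
  (c%:E < alpha_upper J V)%E -> J t ->
  exists2 delta, 0 < delta &
    forall u v, J u -> J v -> u \in `]t - delta, t + delta[ ->
      v \in `]t - delta, t + delta[ -> u < v ->
      V v - V u <= (v - u) `^ c.
Proof.
move=> Vi hc Jt.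
have /ereal_sup_gt[_ [a [a0 ha] <-]] : (c%:E < alpha_upper_at J V t)%E.
  by apply: lt_le_trans hc _; apply: ereal_inf_lbound; exists t.
rewrite lte_fin => ca; have [e /andP[e0 e1] he] := ereal_sup_cvg0_lt1 ha.
exists (e / 2); first by rewrite divr_gt0.
move=> u v Ju Jv ut vt uv; have Vuv := Vi _ _ Ju Jv uv.
have vu0 : 0 < v - u by rewrite subr_gt0.
have := he (v, u); rewrite /distinct_pairs/= !gtr0_norm ?subr_gt0//.
rewrite ltr_pdivrMr ?powR_gt0// mul1r => h.
apply: (@le_trans _ _ ((v - u) `^ a)).
  by apply/ltW/h; split => //; rewrite gt_eqF.
apply: ger_powR; last exact: ltW.
move: ut vt; rewrite !in_itv/= => /andP[? ?] /andP[? ?].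
by apply/andP; split; lra.
Qed.

Lemma alpha_upper_hoelder J V (a b c : R) :
  (forall s t, J s -> J t -> s < t -> V s < V t) ->
  `[a, b]%classic `<=` J -> a < b -> 0 <= c -> (c%:E < alpha_upper J V)%E ->
  exists2 C, 0 < C & forall u v, u \in `[a, b] -> v \in `[a, b] -> u < v ->
    V v - V u <= C * (v - u) `^ c.
Proof.
move=> Vi abJ ab c0 hc.
have [delta d0 hd] : exists2 delta, 0 < delta &
    forall u v, u \in `[a, b] -> v \in `[a, b] -> u < v -> v - u < delta ->
      V v - V u <= (v - u) `^ c.
  pose Q delta u := forall v, u \in `[a, b] -> v \in `[a, b] -> u < v ->
    v - u < delta -> V v - V u <= (v - u) `^ c.
  (* the local scales are made uniform by compactness *)
  have /compact_near_coveringP cK := @segment_compact R a b.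
  have cQ : \forall delta \near 0^'+, `[a, b]%classic `<=` Q delta.
    apply: (cK R (0^'+) Q) => t abt.
    have [e e0 he] := alpha_upper_gt Vi hc (abJ _ abt).
    have e20 : 0 < e / 2 by rewrite divr_gt0.
    exists (ball t (e / 2), [set delta | delta < e / 2]).
      by split; [exact: nbhsx_ballx|exact: nbhs_right_lt].
    move=> [u delta] /= [tu de] v abu abv uv vud.
    move: tu; rewrite /ball/= ltr_distlC => /andP[tu1 tu2].
    by apply: he => //; [exact: abJ|exact: abJ| |]; rewrite in_itv/=;
      apply/andP; split; lra.
  have [delta [d0 hd]] := filter_ex (filterI (nbhs_right_gt 0) cQ).
  by exists delta => // u v abu; exact: hd.
have aab : a \in `[a, b] by rewrite in_itv/= lexx ltW.
have bab : b \in `[a, b] by rewrite in_itv/= lexx ltW.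
have Vab : 0 < V b - V a by rewrite subr_gt0 Vi//; exact: abJ.
have dc0 : 0 < delta `^ c by exact: powR_gt0.
have Vle u v : u \in `[a, b] -> v \in `[a, b] -> u <= v -> V u <= V v.
  move=> abu abv; rewrite le_eqVlt => /predU1P[->//|uv].
  by apply/ltW/Vi => //; exact: abJ.
(* The second summand covers pairs at distance at least delta. *)
exists (1 + (V b - V a) / delta `^ c).
  by rewrite ltr_wpDr// divr_ge0 ?ltW.
move=> u v abu abv uv; have vu0 : 0 < v - u by rewrite subr_gt0.
rewrite mulrDl mul1r; have [small|large] := ltP (v - u) delta.
  by rewrite (le_trans (hd _ _ abu abv uv small))// lerDl !mulr_ge0 ?powR_ge0
    ?invr_ge0 ?ltW.
rewrite ler_wpDl ?powR_ge0//.
have : V v - V u <= V b - V a.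
  move: (abu) (abv); rewrite !in_itv/= => /andP[au ub] /andP[av vb].
  by have := Vle _ _ aab abu au; have := Vle _ _ abv bab vb; lra.
move=> /le_trans; apply; rewrite -mulrA ler_peMr ?(ltW Vab)//.
rewrite mulrC ler_pdivlMr// mul1r.
by apply: ge0_ler_powR; rewrite ?nnegrE// ltW.
Qed.

Lemma hoelder_exponent_le1 V (a b c C : R) : a < b -> V a < V b ->
  (forall u v, u \in `[a, b] -> v \in `[a, b] -> u < v ->
     V v - V u <= C * (v - u) `^ c) -> c <= 1.
Proof.
move=> ab Vab hV; rewrite leNgt; apply/negP => c1.
have ba : 0 < b - a by rewrite subr_gt0.
have p1 : 2 `^ (1 - c) < 1 :> R.
  by apply: powR_lt1; rewrite ?ltr1n//; lra.
have Vab0 : 0 < (V b - V a) / 2 by rewrite divr_gt0 ?subr_gt0.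
have [n hn] :=
  geometric_eventually_le (C * (b - a) `^ c) (powR_ge0 _ _) p1 Vab0.
have M0 : 0 < 2 ^+ n :> R by rewrite exprn_gt0.
suff : V b - V a <= (V b - V a) / 2 by have := Vab0; lra.
apply: le_trans (hn n (leqnn n)).
(* the 2 ^ n increments over the grid add up to O(2 ^ (n * (1 - c))) *)
have -> : V b - V a = \sum_(0 <= k < 2 ^ n)
    (V (grid a b n k.+1) - V (grid a b n k)).
  by rewrite (telescope_sumr (fun k => V (grid a b n k)))// grid_max grid0.
apply: (@le_trans _ _ (\sum_(0 <= k < 2 ^ n) C * ((b - a) / 2 ^+ n) `^ c)).
  apply: ler_sum_nat => k /andP[_ kn]; rewrite -(gridBS a b n k); apply: hV.
  - exact: grid_itv (ltW ab) (ltnW kn).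
  - exact: grid_itv (ltW ab) kn.
  - exact: grid_lt.
rewrite sumr_const_nat subn0 -[leLHS]mulr_natl natrX.
rewrite powRM ?invr_ge0 ?(ltW M0) ?(ltW ba)//.
rewrite -powR_inv1 ?(ltW M0)// -powRrM mulN1r -exprn_powR//.
rewrite powRD ?(gt_eqF M0) ?implybT// powRr1 ?(ltW M0)//.
by rewrite le_eqVlt; apply/orP; left; apply/eqP; ring.
Qed.

End local_exponents_bounds.

(** * Dimension of the graph *)

Section representation.
Context d (T : measurableType d) (R : realType) (P : probability T R).

Lemma measure_ae_eq (E F : set T) : measurable E -> measurable F ->
  {ae P, forall w, E w <-> F w} -> P E = P F.
Proof.
move=> mE mF [N [mN N0 hN]].
have le (A B : set T) : measurable A -> measurable B ->
    A `<=` B `|` N -> (P A <= P B)%E.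
  move=> mA mB AB; rewrite -[leRHS]adde0 -N0.
  apply: (@le_trans _ _ (P (B `|` N))); last exact: measureU2.
  by apply: le_measure => //; rewrite inE//; exact: measurableU.
by apply/eqP; rewrite eq_le; apply/andP; split; apply: le => // w h;
  have [Nw|nNw] := pselect (N w); [right|left|right|left] => //;
  have /contrapT/= e := contra_not (hN w) nNw; apply/e.
Qed.

Lemma brownian_gaussian_increments (J : set R) (X B : R -> {RV P >-> R})
    (V : R -> R) :
  standard_brownian_motion (V @` J) B ->
  {ae P, forall w, forall t, J t -> X t w = B (V t) w} ->
  (forall s t, J s -> J t -> s < t -> V s < V t) ->
  gaussian_increments J X V.
Proof.
move=> hB hX Vi s t Js Jt st; have Vst := Vi s t Js Jt st.
split=> // A mA.
have VJ u : J u -> (V @` J) (V u) by move=> Ju; exists u.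
rewrite -(sbm_normal hB (VJ _ Js) (VJ _ Jt) Vst mA).
have mD (Y : R -> {RV P >-> R}) u v :
    measurable [set w | A (Y u w - Y v w)].
  have : measurable_fun setT (fun w => Y u w - Y v w) by exact: measurable_funB.
  by move=> /(_ measurableT _ mA); rewrite setTI.
apply: measure_ae_eq; [exact: mD|exact: mD|].
by apply: filterS hX => w hw /=; rewrite !hw.
Qed.

(** Collects the exceptional events of all exponents into one; rational exponents
determine the dimension, as they are dense. *)
Lemma ae_forall_rat (Q : rat -> Prop) (A : rat -> T -> Prop) :
  (forall q, Q q -> {ae P, forall w, A q w}) ->
  {ae P, forall w, forall q, Q q -> A q w}.
Proof.
move=> h.
have H (k : nat) : {ae P, forall w, forall q, unpickle k = Some q ->
    Q q -> A q w}.
  case kq : (unpickle k : option rat) => [q|]; last by apply: aeW => w q.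
  have [Qq|nQq] := pselect (Q q); last by apply: aeW => w _ [<-].
  by apply: filterS (h q Qq) => w Aw _ [<-].
move: H => /ae_foralln; apply: filterS => w hw q Qq.
by apply: (hw (pickle q)) => //; rewrite pickleK.
Qed.

End representation.

Section dimension.
Context d (T : measurableType d) (R : realType) (P : probability T R).
Context (S : \bar R) (X : R -> {RV P >-> R}) (V : R -> R).
Local Notation J := (time_interval S).
Context (S_gt0 : (0 < S)%E) (X_gauss : gaussian_increments J X V)
  (X_cont : continuous_paths J X).
Local Notation graph w := (graph_on (fun t => X t w) J).

Lemma variance_incr s t : J s -> J t -> s < t -> V s < V t.
Proof. by move=> Js Jt st; have [] := X_gauss Js Jt st. Qed.

Lemma ae_hausdorff_measure_neq0 (q : R) :
  1 < q -> (q%:E < 2%:E - alpha_lower J V * 2^-1%:E)%E ->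
  {ae P, forall w, hausdorff_measure q (graph w) <> 0%E}.
Proof.
move=> q1 hq.
have : (alpha_lower J V < (2 * (2 - q))%:E)%E.
  move: hq; case: (alpha_lower J V) => [r| |].
  - by rewrite -EFinM -EFinB !lte_fin => h; lra.
  - by rewrite mulyr gtr0_sg ?invr_gt0// mul1e.
  - by rewrite ltNyr.
move=> /(alpha_lower_lt variance_incr)[t [alpha [e [Jt /andP[al0 al1] e0 hV]]]].
have [a [b [ab abJ abe]]] := time_interval_nbhd_segment S_gt0 Jt e0.
apply: (ae_hausdorff_measure_gt0 X_gauss X_cont q1 al0 _ ab abJ); first lra.
move=> u v abu abv uv.
by apply: hV => //; [exact: abJ|exact: abJ|exact: abe|exact: abe].
Qed.

(** The first component is what makes q admissible in the definition of the
dimension; it holds because alpha_upper is at most 1. *)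
Lemma ae_hausdorff_measure_eq0 (q : R) :
  (2%:E - alpha_upper J V * 2^-1%:E < q%:E)%E ->
  {ae P, forall w, 0 <= q /\ hausdorff_measure q (graph w) = 0%E}.
Proof.
move=> hq.
(* J is exhausted by the segments [0, b N]. *)
pose b N : R := if ((N.+1%:R)%:E <= S)%E then N.+1%:R else fine S.
have b0 N : 0 < b N.
  rewrite /b; case: (leP (N.+1%:R)%:E S) => [_|]; first by rewrite ltr0n.
  by case: S S_gt0 => [s| |].
have bJ N : `[0, b N]%classic `<=` J.
  move=> t /=; rewrite in_itv/= => /andP[t0 tb]; split => //.
  move: tb; rewrite /b; case: (leP (N.+1%:R)%:E S) => [h tN|].
    by apply: le_trans h; rewrite lee_fin.
  by case: S S_gt0 => [s| |]//= _ _ ts; rewrite lee_fin.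
have Jb : J `<=` \bigcup_N `[0, b N]%classic.
  move=> t [t0 tS]; exists (Num.truncn t) => //=; rewrite in_itv/= t0/= /b.
  case: (leP (_%:R)%:E S) => [_|]; first exact/ltW/truncnS_gt.
  by move: tS; case: S S_gt0 => [s| |]//=; rewrite lee_fin.
have graphE w : graph w `<=` \bigcup_N graph_on (fun t => X t w) `[0, b N].
  by move=> _ [t /Jb[N _ tN] <-]; exists N => //; exists t.
have hoelder c N : 0 <= c -> (c%:E < alpha_upper J V)%E -> c <= 1 /\
    exists2 C, 0 < C & forall u v, u \in `[0, b N] -> v \in `[0, b N] ->
      u < v -> V v - V u <= C * (v - u) `^ c.
  move=> c0 hc.
  have [C C0 hC] := alpha_upper_hoelder variance_incr (bJ N) (b0 N) c0 hc.
  split; last by exists C.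
  apply: hoelder_exponent_le1 (b0 N) _ hC.
  apply: variance_incr => //; apply: (bJ N).
    by rewrite /= in_itv/= lexx ltW.
  by rewrite /= in_itv/= lexx andbT ltW.
suff H : 0 <= q /\ forall N, {ae P, forall w,
    hausdorff_measure q (graph_on (fun t => X t w) `[0, b N]) = 0%E}.
  have [q0 /ae_foralln] := H; apply: filterS => w hw; split => //.
  apply: hausdorff_measure_eq0_subset (graphE w) _.
  exact: hausdorff_measure_eq0_bigcup.
have [q2|q2] := ltP 2 q.
  split; first lra.
  move=> N; apply: filterS X_cont => w cw.
  apply: hausdorff_measure_gt2_eq0 => //; exact: continuous_subspaceW cw.
have [c qc hc] : exists2 c, 2 * (2 - q) < c & (c%:E < alpha_upper J V)%E.
  move: hq; case: (alpha_upper J V) => [r| |].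
  - rewrite -EFinM -EFinB lte_fin => h.
    by exists ((2 * (2 - q) + r) / 2); rewrite ?lte_fin; lra.
  - by move=> _; exists (2 * (2 - q) + 1); [lra|exact: ltry].
  - by rewrite mulNyr gtr0_sg ?invr_gt0// mul1e.
have c0 : 0 <= c by lra.
split=> [|N]; first by have [c1 _] := hoelder c 0%N c0 hc; lra.
have [c1 [C C0 hC]] := hoelder c N c0 hc.
have cq : 2 - c / 2 < q by lra.
exact: (ae_hausdorff_measure_eq0_itv X_gauss X_cont (b0 N) (bJ N) C0 c1 q2 cq
  hC).
Qed.

Lemma ae_hausdorff_dim_ge : {ae P, forall w,
  (maxe (2%:E - alpha_lower J V * 2^-1%:E) 1 <= hausdorff_dim (graph w))%E}.
Proof.
have J0 : J 0 by split; rewrite // ltW.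
have [a [b [ab abJ _]]] := time_interval_nbhd_segment S_gt0 J0 ltr01.
have := @ae_forall_rat _ _ _ P (fun q => 1 < ratr q :> R /\
    ((ratr q : R)%:E < 2%:E - alpha_lower J V * 2^-1%:E)%E)
  (fun q w => hausdorff_measure (ratr q : R) (graph w) <> 0%E)
  (fun q hq => ae_hausdorff_measure_neq0 hq.1 hq.2).
move: X_cont; apply: filterS2 => w cw hw.
apply: le_ereal_inf_tmp => _ [s [s0 hs] <-].
have s1 : 1 <= s.
  rewrite leNgt; apply/negP => s1.
  exact: (hausdorff_measure_lt1_neq0 cw s0 s1 ab abJ hs).
rewrite ge_max lee_fin s1 andbT leNgt; apply/negP => hlt.
have [r sr hr] : exists2 r, s < r &
    (r%:E <= 2%:E - alpha_lower J V * 2^-1%:E)%E.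
  move: hlt; case: (_ - _)%E => [x| |]//.
  - by rewrite lte_fin => sx; exists x.
  - by move=> _; exists (s + 1); rewrite ?leey// ltrDl.
have [q] := rat_in_itvoo sr; rewrite in_itv/= => /andP[sq qr].
apply: (hw q); last exact: hausdorff_measure_eq0_le s0 (ltW sq) hs.
by split; [exact: le_lt_trans sq|apply: lt_le_trans hr; rewrite lte_fin].
Qed.

Lemma ae_hausdorff_dim_le : {ae P, forall w,
  (hausdorff_dim (graph w) <= 2%:E - alpha_upper J V * 2^-1%:E)%E}.
Proof.
have := @ae_forall_rat _ _ _ P (fun q =>
    (2%:E - alpha_upper J V * 2^-1%:E < (ratr q : R)%:E)%E)
  (fun q w => 0 <= (ratr q : R) /\ hausdorff_measure (ratr q) (graph w) = 0%E)
  (fun q => @ae_hausdorff_measure_eq0 (ratr q)).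
apply: filterS => w hw; rewrite leNgt; apply/negP => hlt.
have [r [x [rx hr hx]]] : exists r x : R, [/\ r < x,
    (2%:E - alpha_upper J V * 2^-1%:E <= r%:E)%E &
    (x%:E <= hausdorff_dim (graph w))%E].
  move: hlt; case: (_ - _)%E => [r| |]; case: (hausdorff_dim _) => [x| |]//.
  - by rewrite lte_fin => rx; exists r, x.
  - by move=> _; exists r, (r + 1); rewrite leey ltrDl.
  - by move=> _; exists (x - 1), x; rewrite leNye ltrBlDr ltrDl.
  - by move=> _; exists 0, 1; rewrite leNye leey.
have [q] := rat_in_itvoo rx; rewrite in_itv/= => /andP[rq qx].
have rqE : (r%:E < (ratr q : R)%:E)%E by rewrite lte_fin.
have [q0 hq] := hw q (le_lt_trans hr rqE).
suff : (hausdorff_dim (graph w) <= (ratr q : R)%:E)%E.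
  by move=> /(le_trans hx); rewrite lee_fin leNgt qx.
by apply: ereal_inf_lbound; exists (ratr q).
Qed.

End dimension.

Theorem theorem1p2 (R : realType) (d : measure_display) (T : measurableType d)
  (P : probability T R) (S : \bar R) (J : set R)
  (X B : R -> {RV P >-> R}) (V : R -> R)
  (S_gt0 : (0 < S)%E)
  (J_def : J = time_interval S)
  (X_cca : centered_continuous_additive_process J X)
  (V_def : forall t, J t -> ('E_P[fun w => (X t w ^+ 2)%R] = (V t)%:E)%E)
  (B_sbm : standard_brownian_motion (V @` J) B)
  (X_repr : {ae P, forall w, forall t, J t -> X t w = B (V t) w})
  (V_incr : forall s t, J s -> J t -> s < t -> V s < V t) :
  {ae P, forall w,
    (maxe (2%:E - alpha_lower J V * 2^-1%:E) 1
       <= hausdorff_dim (graph_on (fun t => X t w) J))%E /\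
    (hausdorff_dim (graph_on (fun t => X t w) J)
       <= 2%:E - alpha_upper J V * 2^-1%:E)%E}.
Proof.
have X_gauss := brownian_gaussian_increments B_sbm X_repr V_incr.
have X_cont := cca_continuous X_cca.
rewrite J_def in X_gauss X_cont *.
have := ae_hausdorff_dim_le S_gt0 X_gauss X_cont.
have := ae_hausdorff_dim_ge S_gt0 X_gauss X_cont.
by apply: filterS2.
Qed.
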